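(* Let $D$ be a division ring that is strongly algebraic over its center $F$ and let $N$ be a subnormal subgroup of $D^*$. If $N$ is finitely generated, then $N$ is central, i.e. $N\subseteq F$.
   Context: For a division ring $D$ with center $F$ and $S\subseteq D$, $F(S)$ denotes the division subring of $D$ generated by $F\cup S$. If every element of $D$ is algebraic over $F$, then $D$ is called strongly algebraic over $F$ if $D$ contains a maximal subfield $K$ such that (i) there exists a subset $S$ of $K$ with $K=F(S)$, and (ii) for each $x\in D$ there are at most finitely many $y\in S$ with $xy\ne yx$. (Algebraicity of $D$ over $F$ is part of the definition.) $D^*$ is the multiplicative group of $D$. *)

(* Defs.v *)
From HB Require Import structures.
From mathcomp Require Import all_boot all_order all_algebra.
From mathcomp Require Import boolp classical_sets functions cardinality.
Set Implicit Arguments.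
Unset Strict Implicit.
Unset Printing Implicit Defensive.
Import GRing.Theory.
Local Open Scope classical_set_scope.
Local Open Scope ring_scope.

(* Subsets of D are classical sets; [in A] is the boolean membership predicate
   of A. *)

(* A unitRingType is nontrivial and need not be commutative. *)
Definition is_division_ring (D : unitRingType) : Prop :=
  forall x : D, x != 0 -> x \is a GRing.unit.

Definition center (D : unitRingType) : set D :=
  [set z | forall x : D, GRing.comm z x].
Arguments center : clear implicits.

(* Because 0^-1 = 0 in MathComp, divring_closed, which asks for closure under
   all quotients x / y, holds for every division subring. *)
Definition division_subring (D : unitRingType) (A : set D) : Prop :=
  GRing.divring_closed [in A].

(* F(S), for F the center of D *)
Definition center_adjoin (D : unitRingType) (S : set D) : set D :=
  smallest (@division_subring D) (center D `|` S).

Definition subfield (D : unitRingType) (K : set D) : Prop :=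
  division_subring K /\ (forall x y, K x -> K y -> GRing.comm x y).

Definition maximal_subfield (D : unitRingType) (K : set D) : Prop :=
  subfield K /\ (forall L : set D, subfield L -> K `<=` L -> L = K).

Definition algebraic_over_center (D : unitRingType) (x : D) : Prop :=
  exists p : {poly D}, [/\ p != 0, p \is a polyOver [in center D] & root p x].

Definition strongly_algebraic (D : unitRingType) : Prop :=
  (forall x : D, algebraic_over_center x) /\
  (exists K : set D, maximal_subfield K /\
     exists S : set D,
       [/\ S `<=` K, K = center_adjoin S &
           forall x : D, finite_set [set y | S y /\ x * y <> y * x]]).

Definition unit_group (D : unitRingType) : set D :=
  [set x | x \is a GRing.unit].
Arguments unit_group : clear implicits.

Definition subgroup_of_units (D : unitRingType) (H : set D) : Prop :=
  H `<=` unit_group D /\ GRing.divr_closed [in H].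

Definition normal_in (D : unitRingType) (A B : set D) : Prop :=
  [/\ subgroup_of_units A, subgroup_of_units B, A `<=` B &
      forall a b, A a -> B b -> A (b^-1 * a * b)].

Definition subnormal_in_units (D : unitRingType) (N : set D) : Prop :=
  exists (r : nat) (C : nat -> set D),
    [/\ C 0%N = unit_group D, C r = N &
        forall i : nat, (i < r)%N -> normal_in (C i.+1) (C i)].

Definition generated_subgroup (D : unitRingType) (G : set D) : set D :=
  smallest (@subgroup_of_units D) G.

Definition finitely_generated (D : unitRingType) (N : set D) : Prop :=
  exists G : set D,
    [/\ finite_set G, G `<=` unit_group D & N = generated_subgroup G].

(* Main.v *)
(* Consider the families h(t) = P(t) / q(t) with q central and h(oo) = 1 that, for
   t in the center, take their values in a group H_i of the subnormal chain.
   If some family in H_i does not commute with a in N, then neither does some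
   family in H_(i+1): otherwise the conjugates of a along the first family would
   be commuting roots of one central polynomial, hence finitely many, and a
   rational function taking finitely many values is constant.  So if a is not
   central, N contains a nonconstant family.
   On the other hand, N lies in the centralizer C of F(S') for a cofinite subset S' of S,
   and C is a finite-dimensional left vector space over the maximal subfield K.
   Right multiplication turns the finitely generated group N into matrices over
   a finitely generated subring R of K, so the coordinates of a family in N are
   rational functions with values in R.  Such a function has no pole as soon as
   the parameters run through an infinite ring with finitely many units: the
   values of a nonconstant polynomial have infinitely many prime divisors, and
   only finitely many primes become invertible in R.  Being 1 at infinity, the
   family is then constant.
   If the center contains no such ring, it is algebraic over a finite field and
   D is commutative by Wedderburn's theorem. *)
Require Import Defs.
From HB Require Import structures.
From mathcomp Require Import all_boot all_order all_algebra all_field ring.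
From mathcomp Require Import boolp classical_sets functions cardinality.
Set Implicit Arguments.
Unset Strict Implicit.
Unset Printing Implicit Defensive.
Import GRing.Theory.
Local Open Scope classical_set_scope.
Local Open Scope ring_scope.

(** * Subrings of a field generated by finitely many elements *)

Section Adjunction.
Variable (Om : fieldType).
Implicit Types (C B : subringClosed Om) (p q V : {poly Om}).

Definition adj C (r : Om) : {pred Om} :=
  fun x => `[< exists2 p, p \is a polyOver C & x = p.[r] >].

Lemma adjP C r x :
  reflect (exists2 p, p \is a polyOver C & x = p.[r]) (x \in adj C r).
Proof. exact: asboolP. Qed.

Lemma adj_subring C r : GRing.subring_closed (adj C r).
Proof.
split=> [|x y /adjP[p Cp ->] /adjP[q Cq ->]|x y /adjP[p Cp ->] /adjP[q Cq ->]];
  apply/adjP.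
- by exists 1; rewrite ?rpred1 // hornerC.
- by exists (p - q); rewrite ?rpredB // !hornerE.
- by exists (p * q); rewrite ?rpredM // !hornerE.
Qed.
HB.instance Definition _ C r :=
  GRing.isSubringClosed.Build Om (adj C r) (adj_subring C r).

Fixpoint adjs C (rs : seq Om) : subringClosed Om :=
  if rs is r :: rs' then adjs (adj C r) rs' else C.

Lemma adj_base C r x : x \in C -> x \in adj C r.
Proof. by move=> Cx; apply/adjP; exists x%:P; rewrite ?polyOverC // hornerC. Qed.

Lemma adj_gen C r : r \in adj C r.
Proof. by apply/adjP; exists 'X; rewrite ?polyOverX // hornerX. Qed.

Lemma adjs_base C rs x : x \in C -> x \in adjs C rs.
Proof. by elim: rs C => //= r rs IH C Cx; apply/IH/adj_base. Qed.

Lemma adjs_gen C rs x : x \in rs -> x \in adjs C rs.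
Proof.
elim: rs C => //= r rs IH C; rewrite inE => /orP[/eqP->|]; last exact: IH.
exact/adjs_base/adj_gen.
Qed.

Lemma adjs_min C rs B : {subset C <= B} -> {subset rs <= B} ->
  {subset adjs C rs <= B}.
Proof.
elim: rs C => //= r rs IH C CB rsB; apply: IH => [x /adjP[p Cp ->]|x xrs].
  apply: rpred_horner; last by apply: rsB; rewrite mem_head.
  exact: (polyOverS CB).
by apply: rsB; rewrite inE xrs orbT.
Qed.

Lemma adjs_sub C rs rs' : {subset rs <= rs'} -> {subset adjs C rs <= adjs C rs'}.
Proof.
by move=> h; apply: adjs_min => x; [apply: adjs_base | move/h; apply: adjs_gen].
Qed.

(** [C] need not contain the inverse of [lead_coef p]. Scaling [V] by [lead_coef p] lets each
    leading term be cancelled inside [C]; [j] counts these scalings. *)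
Lemma pseudo_division C p V : p != 0 -> p \is a polyOver C ->
  V \is a polyOver C ->
  exists j Q E, [/\ Q \is a polyOver C, E \is a polyOver C,
    (size E < size p)%N & lead_coef p ^+ j *: V = Q * p + E].
Proof.
move=> p0 Cp; have [n] := ubnP (size V); elim: n V => // n IH V ltVn CV.
have [lt|le] := ltnP (size V) (size p).
  by exists 0%N, 0, V; rewrite rpred0 expr0 scale1r mul0r add0r.
have CM k : lead_coef V *: 'X^k \is a polyOver C.
  by rewrite polyOverZ ?polyOverXn // lead_coefE (polyOverP CV).
have Cl : lead_coef p \in C by rewrite lead_coefE (polyOverP Cp).
pose k := (size V - size p)%N.
pose W := lead_coef p *: V - (lead_coef V *: 'X^k) * p.
have sV0 : (0 < size V)%N by rewrite (leq_trans _ le) // size_poly_gt0.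
have sz2 : size ((lead_coef V *: 'X^k) * p) = size V.
  have V0 : V != 0 by rewrite -size_poly_gt0.
  rewrite -scalerAl size_scale ?lead_coef_eq0 // mulrC size_mulXn // /k subnK //.
have ltW : (size W < size V)%N.
  rewrite -(prednK sV0) ltnS; apply/leq_sizeP => j.
  rewrite leq_eqVlt => /orP[/eqP <-|lt].
    rewrite coefB coefZ -lead_coefE -scalerAl coefZ coefXnM /k.
    rewrite ltnNge (_ : (_ <= _)%N); last first.
      by rewrite -subn1 leq_sub2l // size_poly_gt0.
    rewrite (_ : ((size V).-1 - (size V - size p) = (size p).-1)%N).
      by rewrite -lead_coefE mulrC subrr.
    by rewrite -subn1 -subnDA addnC subnDA subKn // subn1.
  apply: (leq_sizeP _ _ _); last exact: leqnn.
  have szj : (size V <= j)%N by rewrite -(prednK sV0).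
  apply: (leq_trans (size_polyD _ _)).
  rewrite geq_max size_polyN sz2 szj andbT.
  exact: leq_trans (size_scale_leq _ _) szj.
have CW : W \is a polyOver C by rewrite rpredB ?polyOverZ ?rpredM.
have [j [Q [E [CQ CE ltE eqE]]]] := IH W (leq_trans ltW ltVn) CW.
exists j.+1, (Q + lead_coef p ^+ j *: (lead_coef V *: 'X^k)), E; split=> //.
  by rewrite rpredD // polyOverZ ?rpredX.
rewrite mulrDl addrAC -eqE /W scalerBr.
by rewrite -(scalerAl (lead_coef p ^+ j)) subrK scalerA -exprSr.
Qed.

(** A minimal polynomial up to a scalar: [C] is only a ring, so [p] need not be monic. *)
Definition min_annihilator C (r : Om) p :=
  [/\ p \is a polyOver C, p != 0, root p r &
   forall q, q \is a polyOver C -> root q r -> (size q < size p)%N -> q = 0].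

Lemma min_annihilator_ex C r p : p \is a polyOver C -> p != 0 -> root p r ->
  exists m, min_annihilator C r m.
Proof.
have [n] := ubnP (size p); elim: n p => // n IH p ltpn Cp p0 rp.
have [[q [Cq q0 rq lt]]|no] := pselect (exists q, [/\ q \is a polyOver C, q != 0,
    root q r & (size q < size p)%N]).
  by apply: (IH q) => //; apply: leq_trans lt ltpn.
exists p; split=> // q Cq rq lt; apply/eqP; apply/negP => /negP q0.
by apply: no; exists q.
Qed.

Lemma min_annihilator_size C r p : min_annihilator C r p -> (1 < size p)%N.
Proof.
case=> _ p0 rp _; rewrite ltnNge; apply/negP => /size1_polyC pE.
by move: rp p0; rewrite pE rootC polyC_eq0 => /eqP->; rewrite eqxx.
Qed.

(** Euclid's algorithm for [V] and [p] finds a nonzero multiple of [V.[r]] in [C], in the role of a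
    norm. Each round passes to a shorter polynomial whose value at [r] is still a nonzero multiple
    of [V.[r]]. *)
Lemma min_annihilator_norm C r p V : min_annihilator C r p ->
  V \is a polyOver C -> V.[r] != 0 ->
  exists U h, [/\ U \is a polyOver C, h \in C, h != 0 & U.[r] * V.[r] = h].
Proof.
move=> pm; have [Cp p0 /rootP rp minp] := pm.
have lp0 : lead_coef p != 0 by rewrite lead_coef_eq0.
have [n] := ubnP (size V); elim: n V => // n IH V ltVn CV Vr.
have [le|lt] := leqP (size p) (size V).
  have [j [Q [E [CQ CE ltE eqE]]]] := pseudo_division p0 Cp CV.
  have Er : E.[r] = lead_coef p ^+ j * V.[r].
    by rewrite -hornerZ eqE !hornerE rp mulr0 add0r.
  have Er0 : E.[r] != 0 by rewrite Er mulf_neq0 // expf_neq0.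
  have [|U [h [CU Ch h0 eqh]]] := IH E _ CE Er0.
    exact: leq_ltn_trans (leq_trans ltE le) ltVn.
  exists (lead_coef p ^+ j *: U), h; split=> //.
    by rewrite polyOverZ // rpredX // lead_coefE (polyOverP Cp).
  by rewrite hornerZ mulrAC -Er mulrC.
have V0 : V != 0 by apply: contraNneq Vr => ->; rewrite horner0.
have [le1|lt1] := leqP (size V) 1.
  have VE := size1_polyC le1; exists 1, V`_0; rewrite rpred1 (polyOverP CV).
  by split=> //; move: Vr; rewrite VE !hornerE ?coefC // mul1r.
have [j [Q [E [CQ CE ltE eqE]]]] := pseudo_division V0 CV Cp.
have eqr : Q.[r] * V.[r] = - E.[r].
  apply/eqP; rewrite -addr_eq0 -hornerM -hornerD -eqE hornerZ rp mulr0 //.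
(* Otherwise [Q] would annihilate [r]; as [V] is not constant, [Q] is shorter than [p], against
   minimality. *)
have Er0 : E.[r] != 0.
  apply/eqP => Er; move: eqr; rewrite Er oppr0 => /eqP.
  rewrite mulf_eq0 (negPf Vr) orbF => rQ.
  have szQV : size (Q * V) = size p.
    have -> : Q * V = lead_coef V ^+ j *: p - E by rewrite eqE addrK.
    by rewrite size_polyDl size_scale ?size_polyN ?expf_neq0 ?lead_coef_eq0 ?(ltn_trans ltE).
  have Q0 : Q != 0.
    by apply: contraNneq p0 => Q0; rewrite -size_poly_eq0 -szQV Q0 mul0r size_poly0.
  have := minp Q CQ rQ; rewrite -szQV size_mul //.
  rewrite -(prednK (ltnW lt1)) addnS /= => hQ.
  have /hQ Q00 : (size Q < size Q + (size V).-1)%N.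
    by rewrite -[ltnLHS]addn0 ltn_add2l -ltnS (prednK (ltnW lt1)).
  by rewrite Q00 eqxx in Q0.
have [|U [h [CU Ch h0 eqh]]] := IH E _ CE Er0.
  exact: leq_trans ltE ltVn.
exists (- (U * Q)), h; split=> //; first by rewrite rpredN rpredM.
by rewrite hornerN hornerM mulNr -mulrA eqr mulrN opprK.
Qed.

(** If [r] is algebraic over [C], then [u] is a norm of [v] times the leading coefficient of a
    minimal annihilator; otherwise [u] is the leading coefficient of the polynomial representing
    [v]. *)
Lemma adj_divides_base C r v : v \in adj C r -> v != 0 ->
  exists u, [/\ u \in C, u != 0 & forall c P k, c \in C -> P \in adj C r ->
    c * P = v ^+ k -> exists e k', e \in C /\ c * e = u ^+ k'].
Proof.
case/adjP=> V CV -> Vr.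
have [[p0 [Cp0 p00 rp0]]|trans] :=
  pselect (exists p, [/\ p \is a polyOver C, p != 0 & root p r]).
  have [p pm] := min_annihilator_ex Cp0 p00 rp0.
  have [Cp pn0 /rootP rp minp] := pm.
  have [U [h [CU Ch h0 eqh]]] := min_annihilator_norm pm CV Vr.
  have Cl : lead_coef p \in C by rewrite lead_coefE (polyOverP Cp).
  exists (h * lead_coef p); split; rewrite ?rpredM ?mulf_neq0 ?lead_coef_eq0 //.
  move=> c _ k Cc /adjP[P CP ->] eqc.
  have [j [Q [E [CQ CE ltE eqE]]]] :=
    pseudo_division pn0 Cp (rpredM CP (rpredX k CU)).
  have Er : E.[r] = lead_coef p ^+ j * (P.[r] * U.[r] ^+ k).
    by rewrite -horner_exp -hornerM -hornerZ eqE !hornerE rp mulr0 add0r.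
  pose w := lead_coef p ^+ j * h ^+ k.
  have Cw : w \in C by rewrite rpredM ?rpredX.
  (* This polynomial is shorter than [p] and vanishes at [r], so it is zero; its constant
     coefficient expresses a divisibility inside [C]. *)
  have : c *: E - w%:P = 0.
    apply: minp; first by rewrite rpredB ?polyOverZ ?polyOverC.
      by apply/rootP; rewrite !hornerE Er /w -eqh exprMn -eqc; ring.
    apply: leq_ltn_trans (size_polyD _ _) _; rewrite gtn_max size_polyN.
    rewrite (leq_ltn_trans (size_scale_leq _ _) ltE) /=.
    exact: leq_ltn_trans (size_polyC_leq1 _) (min_annihilator_size pm).
  move/(congr1 (fun q => q`_0)); rewrite coefB coefZ coefC eqxx coef0.
  move/eqP; rewrite subr_eq0 => /eqP eqw.
  exists (E`_0 * (lead_coef p ^+ k * h ^+ j)), (j + k)%N; split.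
    by rewrite !rpredM ?rpredX // (polyOverP CE).
  rewrite [LHS]mulrA eqw /w exprMn !exprD; ring.
(* With [r] transcendental, [c *: P = V ^+ k] holds between polynomials, and leading coefficients
   can be compared. *)
have V0 : V != 0 by apply: contraNneq Vr => ->; rewrite horner0.
exists (lead_coef V); split; rewrite ?lead_coef_eq0 //.
  by rewrite lead_coefE (polyOverP CV).
move=> c _ k Cc /adjP[P CP ->] eqc; exists (lead_coef P), k; split.
  by rewrite lead_coefE (polyOverP CP).
rewrite -lead_coef_exp -[lead_coef P]mul1r mulrA mulr1 -lead_coefZ.
congr lead_coef; apply/eqP; rewrite -subr_eq0; apply/negP => /negP nz.
apply: trans; exists (c *: P - V ^+ k); split=> //.
  by rewrite rpredB ?polyOverZ ?rpredX.
by apply/rootP; rewrite !hornerE eqc subrr.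
Qed.

(** To be used with [v = 1]: the elements of [C] that become invertible after adjoining [rs] all
    divide powers of a single [u]. *)
Lemma adjs_divides_base C rs v : v \in adjs C rs -> v != 0 ->
  exists u, [/\ u \in C, u != 0 & forall c P k, c \in C -> P \in adjs C rs ->
    c * P = v ^+ k -> exists e k', e \in C /\ c * e = u ^+ k'].
Proof.
elim: rs C v => [|r rs IH] C v /= Cv v0.
  by exists v; split=> // c P k Cc CP eqc; exists P, k.
have [u [Cu u0 hu]] := IH _ _ Cv v0.
have [u' [Cu' u'0 hu']] := adj_divides_base Cu u0.
exists u'; split=> // c P k Cc CP eqc.
have [e [k' [Ce eqe]]] := hu c P k (adj_base _ Cc) CP eqc.
exact: hu' Cc Ce eqe.
Qed.

End Adjunction.

(** * Rings with few units *)

(** Distinct commuting elements of a division ring have an invertible difference, so the usual bound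
    on the number of roots applies to them. *)
Lemma finite_comm_roots (D : unitRingType) (p : {poly D}) (Y : set D) :
  is_division_ring D -> p != 0 -> (forall x, Y x -> root p x) ->
  (forall x y, Y x -> Y y -> x * y = y * x) -> finite_set Y.
Proof.
move=> hD p0 Yp Yc; apply: contrapT => /(infinite_set_fset (size p))[B BY].
apply/negP; rewrite -ltnNge; apply: max_ring_poly_roots => //.
  by apply/allP => x xB; apply/Yp/BY.
have: {subset finmap.enum_fset B <= [in Y]} by move=> x xB; rewrite inE; apply: BY.
have: uniq (finmap.enum_fset B) by apply: finmap.fset_uniq.
elim: (finmap.enum_fset B) => //= x s IH /andP[xs us] sY.
rewrite IH // ?andbT; last by move=> y ys; apply: sY; rewrite inE ys orbT.
apply/allP => y ys; rewrite /diff_roots.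
have Yx : Y x by have := sY x (mem_head _ _); rewrite inE.
have Yy : Y y by have := sY y; rewrite !inE ys orbT; apply.
rewrite (Yc _ _ Yx Yy) eqxx; apply: hD; rewrite subr_eq0.
by apply: contraNneq xs => <-.
Qed.

Lemma field_division (F : fieldType) : is_division_ring F.
Proof. by move=> x; rewrite unitfE. Qed.

Lemma finite_roots (F : fieldType) (p : {poly F}) :
  p != 0 -> finite_set [set x | root p x].
Proof.
move=> p0; apply: (finite_comm_roots (@field_division F) p0) => // x y _ _.
exact: mulrC.
Qed.

(* The second set contains 0, since [0^-1 = 0]. *)
Definition few_units (F : fieldType) (A : {pred F}) :=
  infinite_set [set x | x \in A] /\
  finite_set [set x | x \in A /\ x^-1 \in A].

Section FewUnits.
Variables (Om : fieldType) (A : subringClosed Om).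
Hypothesis fewA : few_units A.

(** Put [x = - (w * z)]. Then [1 + w * z] is [1 - x], which divides both [1 - x ^+ k], by the
    geometric sum, and [x ^+ k], a multiple of [w ^+ k]; hence it divides 1. *)
Lemma coprime_divides_unit (w z m : Om) k : w \in A -> z \in A -> m \in A ->
  (1 + w * z) * m = w ^+ k -> (1 + w * z)^-1 \in A.
Proof.
move=> Aw Az Am eqw; pose x := - (w * z).
have Ax : x \in A by rewrite rpredN rpredM.
suff eq1 : ((- z) ^+ k * m + \sum_(i < k) x ^+ i) * (1 + w * z) = 1.
  rewrite -[_^-1]mul1r -{1}eq1 mulfK; last first.
    by apply: contra_eq_neq eq1 => ->; rewrite mulr0 eq_sym oner_neq0.
  by rewrite rpredD ?rpredM ?rpredX ?rpredN // rpred_sum // => i _; rewrite rpredX.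
rewrite mulrDl -mulrA [m * _]mulrC eqw -exprMn mulNr [z * w]mulrC -/x.
have -> : 1 + w * z = - (x - 1) by rewrite /x opprB opprK.
by rewrite mulrN mulrC -subrX1 opprB addrC subrK.
Qed.

Lemma horner_divides_diff (p : {poly Om}) t0 t : p \is a polyOver A ->
  t0 \in A -> t \in A -> exists2 g, g \in A & p.[t] = p.[t0] + (t - t0) * g.
Proof.
move=> Ap At0 At; have AX : 'X - t0%:P \is a polyOver A.
  by rewrite rpredB ?polyOverX ?polyOverC.
have [j [Q [E [AQ AE ltE]]]] := pseudo_division (negbT (polyXsubC_eq0 t0)) AX Ap.
rewrite lead_coefXsubC expr1n scale1r => pE.
have EE : E = (E`_0)%:P by apply: size1_polyC; move: ltE; rewrite size_XsubC.
exists Q.[t]; first exact: rpred_horner.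
by rewrite pE EE !hornerE subrr mulr0 add0r addrC mulrC.
Qed.

(* [p (t0 + p(t0) w s)] is [p(t0)] times an element congruent to 1 modulo [w],
   which divides a power of [w] only if it is a unit. *)
Lemma poly_values_not_S_units (p : {poly Om}) (w : Om) :
  p \is a polyOver A -> (1 < size p)%N -> w \in A -> w != 0 ->
  infinite_set [set t | t \in A /\
    forall m k, m \in A -> p.[t] * m <> w ^+ k].
Proof.
move=> Ap p1 Aw w0; have [Ainf Ufin] := fewA.
have p0 : p != 0 by rewrite -size_poly_gt0 ltnW.
move=> Zfin; pose Z := [set t | t \in A /\
    forall m k, m \in A -> p.[t] * m <> w ^+ k].
have [t0 [At0 pt0]] : exists t0, t0 \in A /\ p.[t0] != 0.
  apply: contrapT => no; apply: Ainf; apply: sub_finite_set (finite_roots p0).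
  move=> t At; apply/rootP/eqP; apply: contrapT => /negP ne.
  by apply: no; exists t.
pose c := p.[t0]; pose f s := t0 + c * w * s.
have cw0 : c * w != 0 by rewrite mulf_neq0.
have Ac : c \in A by rewrite rpred_horner.
have Af s : s \in A -> f s \in A by move=> As; rewrite rpredD ?rpredM.
have [U Uf] : exists U, U = [set x | x \in A /\ x^-1 \in A] by eexists.
rewrite -Uf in Ufin.
(* [f] is injective because [c * w] is nonzero, so a finite image would make [A] finite. *)
suff /(finite_image (fun t => (t - t0) / (c * w))) fin :
    finite_set (f @` [set s | s \in A]).
  apply: Ainf; apply: sub_finite_set fin => s As; exists (f s); first by exists s.
  by rewrite /f addrC addKr mulrC mulKf.
(* If [f s] is outside [Z], the value of [p] there is [c * y] with [y] in the finite set [U], and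
   each such value is taken finitely often. *)
apply: (@sub_finite_set _ _
    (Z `|` \bigcup_(y in U) [set t | root (p - (c * y)%:P) t])).
  move=> _ [s As <-]; have Afs := Af s As.
  have [Zt|nZ] := pselect (Z (f s)); [by left | right].
  have [m [k [Am eqm]]] : exists m k, m \in A /\ p.[f s] * m = w ^+ k.
    apply: contrapT => no; apply: nZ; split=> // m k Am eqm; apply: no.
    by exists m, k.
  have [g Ag pg] := horner_divides_diff Ap At0 Afs.
  have pfs : p.[f s] = c * (1 + w * (s * g)) by rewrite pg /f /c; ring.
  exists (1 + w * (s * g)).
    rewrite Uf; split; first by rewrite rpredD ?rpredM ?rpred1.
    apply: (@coprime_divides_unit _ _ (c * m) k); rewrite ?rpredM //.
    by rewrite -eqm pfs; ring.
  by apply/rootP; rewrite hornerD hornerN hornerC pfs subrr.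
rewrite finite_setU; split=> //; apply: bigcup_finite => // y _.
apply: finite_roots; apply: contraTneq p1 => /eqP; rewrite subr_eq0 => /eqP->.
by rewrite -leqNgt size_polyC_leq1.
Qed.

(** Otherwise almost all [t - rho] would divide powers of one [u] in [adj A rho]. For algebraic
    [rho], norms make almost all [p.[t]], with [p] a minimal annihilator, divide powers of a fixed
    element of [A]; for transcendental [rho], almost all [t] are roots of one polynomial. *)
Lemma inverse_not_fg (rs : seq Om) (rho : Om) :
  infinite_set [set t | t \in A /\ (t - rho)^-1 \notin adjs A rs].
Proof.
have [Ainf _] := fewA; move=> Zfin.
pose C := (adj A rho : subringClosed Om).
have [u [Cu u0 hu]] := adjs_divides_base (rpred1 (adjs C rs)) (oner_neq0 Om).
have AC : {subset adjs A rs <= adjs C rs}.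
  apply: adjs_min => x; last exact: adjs_gen.
  by move/adj_base => /(_ rho); apply: adjs_base.
pose bad := [set t | t \in A /\ (t - rho)^-1 \notin adjs A rs] `|` [set rho].
have badfin : finite_set bad by rewrite finite_setU; split.
have good t : t \in A -> ~ bad t -> exists e k, e \in C /\ (t - rho) * e = u ^+ k.
  move=> At nb; apply: (hu _ (t - rho)^-1 1%N).
  - by rewrite rpredB ?adj_gen ?adj_base.
  - apply: AC; apply: contrapT => /negP no; apply: nb; left; split=> //.
  - rewrite expr1 divff // subr_eq0; apply/negP => /eqP tr; apply: nb; by right.
have [U AU uU] := adjP _ _ _ Cu.
have [[p1 [Ap1 p10 rp1]]|trans] :=
  pselect (exists p, [/\ p \is a polyOver A, p != 0 & root p rho]).
  have [p pm] := min_annihilator_ex Ap1 p10 rp1.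
  have [Ap p0 /rootP rp minp] := pm.
  have := u0; rewrite uU => Ur.
  have [U' [h [AU' Ah h0 eqh]]] := min_annihilator_norm pm AU Ur.
  have Al : lead_coef p \in A by rewrite lead_coefE (polyOverP Ap).
  have w0 : lead_coef p * h != 0 by rewrite mulf_neq0 ?lead_coef_eq0.
  apply: (poly_values_not_S_units Ap (min_annihilator_size pm) (rpredM Al Ah) w0).
  apply: sub_finite_set badfin => t [At not]; apply: contrapT => nb.
  have [_ [k [/adjP[E AE ->] eqE]]] := good t At nb.
  (* [G] vanishes at [rho], so [p] divides it up to a scalar. At [t] the first term of [G] vanishes,
     so [p.[t]] divides a product of powers of [lead_coef p] and [h]. *)
  pose G := (t%:P - 'X) * (E * U' ^+ k) - (h ^+ k)%:P.
  have AG : G \is a polyOver A.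
    by rewrite rpredB ?rpredM ?rpredX ?rpredB ?polyOverC ?polyOverX ?rpredX.
  have Gr : G.[rho] = 0.
    by rewrite !(hornerD, hornerN, hornerM, horner_exp, hornerC, hornerX) mulrA eqE uU -exprMn mulrC eqh subrr.
  have [j [Q [R [AQ AR ltR eqR]]]] := pseudo_division p0 Ap AG.
  have R0 : R = 0.
    apply: minp => //; apply/rootP.
    by have := congr1 (horner^~ rho) eqR; rewrite hornerZ Gr hornerD hornerM rp !mulr0 add0r.
  have Gt : p.[t] * Q.[t] = - (lead_coef p ^+ j * h ^+ k).
    have := congr1 (horner^~ t) eqR.
    rewrite R0 addr0 hornerZ hornerM [p.[t] * _]mulrC => <-; rewrite /G.
    by rewrite !(hornerD, hornerN, hornerM, hornerC, hornerX) subrr mul0r sub0r mulrN mulrC.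
  apply: (not (- (Q.[t] * (lead_coef p ^+ k * h ^+ j))) (j + k)%N).
    by rewrite rpredN !rpredM ?rpredX ?rpred_horner.
  by rewrite mulrN !mulrA Gt exprMn !exprD; ring.
have U0 : U != 0 by apply: contraNneq u0 => U0; rewrite uU U0 horner0.
apply: Ainf; apply: (@sub_finite_set _ _ (bad `|` [set t | root U t])); last first.
  by rewrite finite_setU; split=> //; apply: finite_roots.
move=> t /= At; have [|nb] := pselect (bad t); [by left | right].
have [_ [k [/adjP[E AE ->] eqE]]] := good t At nb.
have eqU : (t%:P - 'X) * E = U ^+ k.
  apply/eqP; rewrite -subr_eq0; apply/negP => /negP nz; apply: trans.
  exists ((t%:P - 'X) * E - U ^+ k); split=> //.
    by rewrite rpredB ?rpredM ?rpredB ?rpredX ?polyOverC ?polyOverX.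
  by apply/rootP; rewrite !hornerE eqE uU subrr.
apply/rootP/eqP; have := congr1 (horner^~ t) eqU.
rewrite !hornerE subrr mul0r => /esym/eqP; rewrite expf_eq0.
by case/andP.
Qed.

End FewUnits.

(** * Rational functions with values in a finitely generated ring *)

Section Image.
Variables (F Om : fieldType) (f : {rmorphism F -> Om}).

Definition img (A : {pred F}) : {pred Om} :=
  fun y => `[< exists2 x, x \in A & y = f x >].

Lemma imgP (A : {pred F}) y : reflect (exists2 x, x \in A & y = f x) (y \in img A).
Proof. exact: asboolP. Qed.

Lemma img_subring (A : subringClosed F) : GRing.subring_closed (img A).
Proof.
split=> [|_ _ /imgP[x Ax ->] /imgP[y Ay ->]|_ _ /imgP[x Ax ->] /imgP[y Ay ->]];
  apply/imgP.
- by exists 1; rewrite ?rpred1 // rmorph1.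
- by exists (x - y); rewrite ?rpredB // rmorphB.
- by exists (x * y); rewrite ?rpredM // rmorphM.
Qed.
HB.instance Definition _ (A : subringClosed F) :=
  GRing.isSubringClosed.Build Om (img A) (img_subring A).

Lemma map_adjs (A : subringClosed F) (B : subringClosed Om) rs :
  {homo f : x / x \in A >-> x \in B} ->
  {homo f : x / x \in adjs A rs >-> x \in adjs B (map f rs)}.
Proof.
elim: rs A B => //= r rs IH A B AB; apply: IH => _ /adjP[p Ap ->]; apply/adjP.
exists (map_poly f p); last by rewrite horner_map.
by apply/polyOverP => i; rewrite coef_map; apply/AB/(polyOverP Ap).
Qed.

Lemma img_adjs (A : subringClosed F) rs x : x \in adjs A rs ->
  f x \in adjs (img A) (map f rs).
Proof. by apply: map_adjs x => x Ax; apply/imgP; exists x. Qed.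

Lemma img_few_units (A : subringClosed F) : few_units A -> few_units (img A).
Proof.
case=> Ainf Ufin; split.
  move=> fin; apply: Ainf.
  have [g gK] : exists g : Om -> F, cancel f g.
    exists (fun y => if pselect (exists x, f x = y) is left e then projT1 (cid e) else 0).
    move=> x; case: pselect => [e|[]]; last by exists x.
    by case: cid => z /= /fmorph_inj.
  apply: sub_finite_set (finite_image g fin) => x /= Ax; exists (f x) => //.
  by apply/imgP; exists x.
apply: sub_finite_set (finite_image f Ufin) => _ [/imgP[x Ax ->] /imgP[y Ay]].
rewrite -fmorphV => /fmorph_inj xy; exists x => //; split=> //.
by rewrite xy.
Qed.

End Image.

Lemma irreducible_factor (F : fieldType) (p : {poly F}) : (1 < size p)%N ->
  exists2 q, irreducible_poly q & q %| p.
Proof.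
have [n] := ubnP (size p); elim: n p => // n IH p ltpn p1.
have [irr|] := pselect (irreducible_poly p); first by exists p.
move=> nirr; have [q [q1 qp nqp]] : exists q : {poly F}, [/\ size q != 1%N, q %| p & ~~ (q %= p)].
  apply: contrapT => no; apply: nirr; split=> // q q1 qp; apply: contrapT => /negP nqp.
  by apply: no; exists q.
have p0 : p != 0 by rewrite -size_poly_gt0 ltnW.
have q0 : q != 0 by apply: contraTneq qp => ->; rewrite dvd0p.
have ltqp : (size q < size p)%N.
  by rewrite ltn_neqAle dvdp_leq // andbT dvdp_size_eqp.
have [||r irr rq] := IH q; first exact: leq_trans ltqp ltpn.
  by rewrite ltn_neqAle eq_sym q1 size_poly_gt0.
by exists r => //; apply: dvdp_trans qp.
Qed.

Section RationalValues.
Variables (F : fieldType) (A : subringClosed F).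
Hypothesis fewA : few_units A.

(* If the reduced denominator had a root [rho], in some extension, then by
   Bezout the finitely generated ring spanned by the data would contain almost
   all the [(t - rho)^-1]. *)
Lemma denominator_divides (rs : seq F) (P q : {poly F}) : q != 0 ->
  (forall t, t \in A -> q.[t] != 0 -> P.[t] / q.[t] \in adjs A rs) -> q %| P.
Proof.
move=> q0 Pq; pose g := gcdp P q.
have g0 : g != 0 by rewrite gcdp_eq0 negb_and q0 orbT.
have [P1 PE] := dvdpP _ _ (dvdp_gcdl P q); have [q1 qE] := dvdpP _ _ (dvdp_gcdr P q).
rewrite -/g in PE qE.
have q10 : q1 != 0 by apply: contraNneq q0 => q10; rewrite qE q10 mul0r.
have [sz|sz] := leqP (size q1) 1.
  rewrite qE PE dvdp_mul2r //; apply: dvdp_trans (dvd1p P1).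
  by rewrite dvdp1 eqn_leq sz size_poly_gt0.
exfalso; have [[u v] /= uv] : exists w, w.1 * P1 + w.2 * q1 = 1.
  apply/Bezout_eq1_coprimepP.
  have : coprimep (P %/ g) (q %/ g) by apply: coprimep_div_gcd; rewrite q0 orbT.
  by rewrite PE qE !mulpK.
have [r irr /dvdpP[s rE]] := irreducible_factor sz.
have [L _ [rho rrho _]] := irredp_FAdjoin irr.
pose f := GRing.in_alg L : {rmorphism F -> L}.
have root_rho : root (map_poly f q1) rho.
  by rewrite rE rmorphM rootM rrho orbT.
have [h hE] := factor_theorem _ _ root_rho.
(* The data of the formula for [(f t - rho)^-1] below: the generators [rs], the Bezout coefficients
   [u] and [v], and the cofactor [h] of [rho] in [q1]. *)
pose rs' := map f (rs ++ (u : seq F) ++ (v : seq F)) ++ (h : seq L).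
pose B := adjs (img f A) rs'.
have Brs x : x \in adjs A (rs ++ (u : seq F) ++ (v : seq F)) -> f x \in B.
  move/(img_adjs f); apply: adjs_sub => y; rewrite mem_cat => ->//.
have polyB (p : {poly F}) t : t \in A ->
    {subset (p : seq F) <= rs ++ (u : seq F) ++ (v : seq F)} -> f p.[t] \in B.
  move=> At sub; apply: Brs; apply: rpred_horner; last exact: adjs_base.
  apply/polyOverP => i; have [lt|le] := ltnP i (size p).
    by apply: adjs_gen; apply: sub; apply: mem_nth.
  by rewrite nth_default // rpred0.
apply: (inverse_not_fg (img_few_units f fewA) (rs := rs') (rho := rho)).
apply: (@sub_finite_set _ _ (f @` [set t | root q t])); last first.
  by apply: finite_image; apply: finite_roots.
move=> _ [/imgP[t At ->] nB]; exists t => //=; apply: contraNT nB => qt.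
have fq1 : f q1.[t] = h.[f t] * (f t - rho).
  by rewrite -horner_map hE !hornerE.
have q1t : f q1.[t] != 0.
  by rewrite fmorph_eq0; apply: contraNneq qt => q1t; rewrite qE rootM /root q1t eqxx.
(* Divide [u * P1 + v * q1 = 1] by [q1] and multiply by [h]. *)
have -> : (f t - rho)^-1 = h.[f t] * (f u.[t] * f (P.[t] / q.[t]) + f v.[t]).
  have -> : P.[t] / q.[t] = P1.[t] / q1.[t].
    move: qt; rewrite /root PE qE !hornerM mulf_eq0 negb_or => /andP[_ gt].
    by rewrite invfM mulrACA divff // mulr1.
  have := congr1 (fun p => f p.[t]) uv; rewrite !hornerE rmorphD !rmorphM rmorph1.
  move=> eq1; move: q1t eq1; rewrite fmorphV !fq1 mulf_eq0 negb_or.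
  case/andP=> ht0 tr0 eq1; apply: (mulfI tr0); rewrite divff // -eq1.
  move: ht0 tr0; move: (f t - rho) h.[f t] (f u.[t]) (f v.[t]) (f P1.[t]).
  by move=> a b c d e b0 a0; field; rewrite b0 a0.
have BAt : f t \in B by apply/adjs_base/imgP; exists t.
rewrite rpredM //.
  apply: rpred_horner => //; apply/polyOverP => i.
  have [lt|le] := ltnP i (size h); last by rewrite nth_default // rpred0.
  by apply: adjs_gen; rewrite mem_cat mem_nth ?orbT.
rewrite rpredD ?rpredM //; try by apply: polyB => // x xu; rewrite !mem_cat xu ?orbT.
apply: Brs; apply: adjs_sub (Pq t At qt) => x xrs; rewrite mem_cat xrs //.
Qed.

End RationalValues.

(** * Rational families of units *)

Section Groups.
Variable (D : unitRingType).

Lemma subgroup_mulV (H : set D) x y : subgroup_of_units H -> H x -> H y ->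
  H (x / y).
Proof.
move=> [_ [_ Hdiv]] Hx Hy; have := Hdiv x y; rewrite !inE; exact.
Qed.

Lemma subgroup_one (H : set D) : subgroup_of_units H -> H 1.
Proof. by move=> [_ []]; rewrite inE. Qed.

Lemma subgroup_inv (H : set D) x : subgroup_of_units H -> H x -> H x^-1.
Proof.
by move=> Hg Hx; rewrite -[_^-1]mul1r; apply: subgroup_mulV => //; apply: subgroup_one.
Qed.

Lemma subgroup_mul (H : set D) x y : subgroup_of_units H -> H x -> H y -> H (x * y).
Proof.
move=> Hg Hx Hy; rewrite -[y]invrK; apply: subgroup_mulV => //.
exact: subgroup_inv.
Qed.

End Groups.

Section Families.
Variable (D : unitRingType).
Hypothesis hD : is_division_ring D.
Implicit Types (a b t : D) (p P Q q : {poly D}).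

Lemma division_mulf_eq0 (x y : D) : x * y = 0 -> x = 0 \/ y = 0.
Proof.
have [->|x0] := eqVneq x 0; first by left.
by move=> xy; right; rewrite -[y](mulKr (hD x0)) xy mulr0.
Qed.

Lemma central_inv t : center D t -> center D t^-1.
Proof.
move=> ct x; have [->|t0] := eqVneq t 0; first by rewrite invr0; apply: commr_sym; apply: commr0.
by apply: commr_sym; apply: commrV; apply: commr_sym.
Qed.

Definition central_poly p := forall r : {poly D}, r * p = p * r.

Lemma center0 : center D 0.
Proof. by move=> x; rewrite /GRing.comm mul0r mulr0. Qed.

Lemma polyOver_centerP p :
  p \is a polyOver [in center D] <-> forall i, center D p`_i.
Proof.
split=> [/allP cp i|cp].
  have [lt|le] := ltnP i (size p); last by rewrite nth_default //; apply: center0.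
  by have := cp _ (mem_nth 0 lt); rewrite !inE.
apply/allP => x /(nthP 0)[i _ <-]; rewrite !inE; exact: cp.
Qed.

Lemma polyOver_central p : p \is a polyOver [in center D] -> central_poly p.
Proof.
move=> /polyOver_centerP cp r; apply/polyP => i; rewrite coefM coefMr.
by apply: eq_bigr => j _; rewrite (cp (i - j)%N).
Qed.

Lemma central_hornerM t p q : center D t -> (p * q).[t] = p.[t] * q.[t].
Proof. by move=> ct; apply: hornerM_comm; apply: ct. Qed.

Lemma central_poly_horner t p : center D t -> central_poly p -> center D p.[t].
Proof.
move=> ct cp x; rewrite /GRing.comm -[in LHS](hornerC x t) -[in RHS](hornerC x t).
by rewrite -!central_hornerM ?cp.
Qed.

Lemma central_polyM p q : central_poly p -> central_poly q -> central_poly (p * q).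
Proof. by move=> cp cq r; rewrite mulrA cp -!mulrA cq. Qed.

Lemma monic_annihilator b : algebraic_over_center b ->
  exists p, [/\ p \is monic, p \is a polyOver [in center D] & root p b].
Proof.
case=> p [p0 cp rp]; have lu := hD (etrans (f_equal negb (lead_coef_eq0 p)) p0).
have cl : center D (lead_coef p).
  by rewrite lead_coefE; apply: (polyOver_centerP p).1.
have cl' := central_inv cl.
exists ((lead_coef p)^-1 *: p); split.
- rewrite monicE lead_coefE coefZ.
  have -> : size ((lead_coef p)^-1 *: p) = size p.
    by apply: lreg_size; apply: mulrI; rewrite unitrV.
  rewrite -lead_coefE mulVr //.
- apply/polyOver_centerP => i x; rewrite coefZ.
  have cpi := (polyOver_centerP p).1 cp i.
  by apply: commr_sym; apply: commrM; apply: commr_sym; [apply: cl' | apply: cpi].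
- by rewrite /root hornerZ (rootP rp) mulr0.
Qed.

Lemma root_conj p a u : p \is a polyOver [in center D] -> u \is a GRing.unit ->
  root p a -> root p (u^-1 * a * u).
Proof.
move=> /polyOver_centerP cp uu /rootP; rewrite /root !horner_coef => eq0.
have -> : \sum_(i < size p) p`_i * (u^-1 * a * u) ^+ i =
   u^-1 * (\sum_(i < size p) p`_i * a ^+ i) * u.
  rewrite mulr_sumr mulr_suml; apply: eq_bigr => i _.
  have -> : (u^-1 * a * u) ^+ i = u^-1 * a ^+ i * u.
    elim: (val i) => [|n IH]; first by rewrite !expr0 mulr1 mulVr.
    by rewrite !exprS IH !mulrA mulrK // -!mulrA.
  by rewrite !mulrA (cp i u^-1).
by rewrite eq0 mulr0 mul0r.
Qed.

(* [P / q] as a rational function of a central variable, with inverse [Q / q];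
   since [P] and [q] are monic of the same degree, its value at infinity is 1. *)
Definition central_family P Q q :=
  [/\ P \is monic, Q \is monic, q \is monic & size P = size q] /\
  [/\ central_poly q, P * Q = q * q & Q * P = q * q].

Definition values_in (C : set D) P q :=
  forall t, center D t -> q.[t] != 0 -> C (P.[t] / q.[t]).

Lemma family_inv P Q q : central_family P Q q -> central_family Q P q.
Proof.
move=> [[mP mQ mq sz] [cq PQ QP]]; do 2!split=> //.
have := congr1 (fun p : {poly D} => size p) QP.
rewrite !size_monicM ?monic_neq0 // sz => /(congr1 succn).
have s0 : (0 < size q)%N by rewrite size_poly_gt0 monic_neq0.
by rewrite !prednK ?addn_gt0 ?s0 ?orbT // => /addIn.
Qed.

Lemma family_valV P Q q t : central_family P Q q -> center D t -> q.[t] != 0 ->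
  P.[t] / q.[t] \is a GRing.unit /\ (P.[t] / q.[t])^-1 = Q.[t] / q.[t].
Proof.
move=> [_ [cq PQ QP]] ct qt; have qu := hD qt.
have cqt : center D (q.[t])^-1 by apply/central_inv/central_poly_horner.
have e1 : (P.[t] / q.[t]) * (Q.[t] / q.[t]) = 1.
  rewrite -mulrA (cqt (Q.[t] / _)) !mulrA -central_hornerM // PQ central_hornerM //.
  by rewrite mulrK // divrr.
have u1 : P.[t] / q.[t] \is a GRing.unit.
  apply: hD; apply/eqP => z; move/eqP: e1; rewrite z mul0r eq_sym.
  by rewrite oner_eq0.
by split=> //; apply: (mulrI u1); rewrite e1 divrr.
Qed.

Lemma family_conj P Q q w : w \is a GRing.unit -> central_family P Q q ->
  central_family (w^-1%:P * P * w%:P) (w^-1%:P * Q * w%:P) q.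
Proof.
move=> uw [[mP mQ mq sz] [cq PQ QP]].
have szE p : size (w^-1%:P * p * w%:P) = size p.
  by rewrite rreg_size ?mul_polyC ?lreg_size //; [apply: mulrI; rewrite unitrV|apply: mulIr].
have lcE p : lead_coef (w^-1%:P * p * w%:P) = w^-1 * lead_coef p * w.
  by rewrite !lead_coefE szE coefMC coefCM.
have cc p r : (w^-1%:P * p * w%:P) * (w^-1%:P * r * w%:P) = w^-1%:P * (p * r) * w%:P.
  by rewrite !mulrA -[_ * w%:P * w^-1%:P]mulrA -polyCM divrr // mulr1.
have cq2 : w^-1%:P * (q * q) * w%:P = q * q.
  by rewrite (central_polyM cq cq) -mulrA -polyCM mulVr // mulr1.
do 2!split=> //.
- by rewrite monicE lcE (monicP mP) mulr1 mulVr.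
- by rewrite monicE lcE (monicP mQ) mulr1 mulVr.
- by rewrite szE.
- by rewrite cc PQ.
- by rewrite cc QP.
Qed.

Lemma family_mul P1 Q1 q1 P2 Q2 q2 : central_family P1 Q1 q1 -> central_family P2 Q2 q2 ->
  central_family (P1 * P2) (Q2 * Q1) (q1 * q2).
Proof.
move=> [[mP mQ mq sz] [cq PQ QP]] [[mP' mQ' mq' sz'] [cq' PQ' QP']].
have qq : q1 * q2 * (q1 * q2) = q1 * q1 * (q2 * q2).
  by rewrite -mulrA [q2 * (q1 * q2)]mulrA (cq q2) !mulrA.
do 2!split; rewrite ?monicMl //; last 3 first.
- exact: central_polyM.
- rewrite mulrA -[P1 * P2 * Q2]mulrA PQ' (central_polyM cq' cq') -mulrA PQ qq.
  exact: central_polyM.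
- by rewrite mulrA -[Q2 * Q1 * P1]mulrA QP (central_polyM cq cq) -mulrA QP' qq.
by rewrite !size_monicM ?monic_neq0 // sz sz'.
Qed.

End Families.

(** * Noncommuting families along a subnormal chain *)

Section FamiliesAlongChain.
Variable (D : unitRingType).
Hypothesis hD : is_division_ring D.
Hypothesis infF : infinite_set (center D).
Implicit Types (a b t : D) (p P Q q : {poly D}).

(** This is the family [1 + b / t]. A central annihilator [mu] of [- b] is a multiple of
    ['X + b%:P], so the inverse family is also polynomial over the central denominator ['X * mu]. *)
Lemma family_linear b : algebraic_over_center (- b) ->
  exists P Q q mu, [/\ central_family P Q q, P = ('X + b%:P) * mu, mu \is monic & central_poly mu].
Proof.
case/(monic_annihilator hD) => mu [mmu /polyOver_central cmu /factor_theorem[G]].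
rewrite polyCN opprK => muE.
have mX : 'X + b%:P \is monic by rewrite -[b]opprK polyCN monicXsubC.
have mG : G \is monic by rewrite -(monicMr _ mX) -muE.
have muE' : mu = ('X + b%:P) * G.
  apply: (monic_rreg mX); rewrite -mulrA -muE -cmu //.
have cX : central_poly ('X : {poly D}) by move=> r; rewrite commr_polyX.
exists (('X + b%:P) * mu), ('X * 'X * G), ('X * mu), mu; split=> //.
have mXX : ('X : {poly D}) \is monic by apply: monicX.
have e1 : 'X * mu * ('X * mu) = 'X * 'X * (mu * mu).
  by rewrite -mulrA [mu * ('X * mu)]mulrA (cX mu) !mulrA.
do 2!split; rewrite ?monicMl //; last 3 first.
- exact: central_polyM.
- rewrite e1 [LHS]mulrA (central_polyM cX cX) -mulrA (cmu ('X + b%:P)).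
  by rewrite -[mu * _ * _]mulrA -muE'.
- by rewrite e1 [LHS]mulrA -['X * 'X * G * _]mulrA -muE -[LHS]mulrA.
rewrite !size_monicM ?monic_neq0 // -[b]opprK polyCN size_XsubC size_polyX //.
Qed.

Lemma family_conj_val P q t w : center D t -> central_poly q -> q.[t] != 0 ->
  (w^-1%:P * P * w%:P).[t] / q.[t] = w^-1 * (P.[t] / q.[t]) * w.
Proof.
move=> ct cq qt; have cqt : center D (q.[t])^-1 by apply/central_inv/central_poly_horner.
by rewrite !central_hornerM // !hornerC -!mulrA (cqt w).
Qed.

Lemma comm_family_val P q t a : center D t -> central_poly q ->
  P * a%:P = a%:P * P -> (P.[t] / q.[t]) * a = a * (P.[t] / q.[t]).
Proof.
move=> ct cq /(congr1 (horner^~ t)); rewrite !central_hornerM // !hornerC => e.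
have cqt : center D (q.[t])^-1 by apply/central_inv/central_poly_horner.
by rewrite mulrA -e -!mulrA (cqt a).
Qed.

Section Step.
Variables (C C' : set D) (a : D).
Hypothesis nCC' : normal_in C' C.
Hypothesis C'a : C' a.
Hypothesis alg_a : algebraic_over_center a.

(* If every family with values in [C'] commuted with [a], the conjugates of
   [a] along a central_family with values in [C] would commute with each other.  Being
   roots of one central polynomial they would be finitely many, hence constant
   along the central_family, hence equal to their value [a] at infinity. *)
Lemma noncommuting_family_step P Q q : central_family P Q q -> values_in C P q ->
  P * a%:P <> a%:P * P ->
  exists P' Q' q', [/\ central_family P' Q' q', values_in C' P' q' & P' * a%:P <> a%:P * P'].
Proof.
move=> fam valC nPa; apply: contrapT => no.
have [gC' gC sC'C norm] := nCC'.
have comm P' Q' q' : central_family P' Q' q' -> values_in C' P' q' -> P' * a%:P = a%:P * P'.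
  by move=> f' v'; apply: contrapT => n'; apply: no; exists P', Q', q'.
have [[mP mQ mq sz] [cq PQ QP]] := fam.
have ua : a \is a GRing.unit by apply: gC'.1.
pose h t := P.[t] / q.[t]; pose y t := (h t)^-1 * a * h t.
pose U := [set t | center D t /\ q.[t] != 0].
have hC t : U t -> C (h t) by case; apply: valC.
have hu t : U t -> h t \is a GRing.unit by move/hC; apply: gC.1.
(* [K / (q * q)] is the family of commutators of [a] and [h t]. Its values [a^-1 * y t] lie in [C'],
   since [a] and its conjugate [y t] do. *)
pose K := a^-1%:P * Q * a%:P * P.
have famK : central_family K (Q * (a^-1%:P * P * a%:P)) (q * q).
  exact: family_mul (family_conj ua (family_inv fam)) fam.
have KE t : U t -> K.[t] / (q * q).[t] = a^-1 * y t.
  move=> [ct qt]; have qu := hD qt; rewrite /K !central_hornerM // !hornerC /y.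
  have [_ ->] := family_valV hD fam ct qt; rewrite /h invrM //.
  have cqt : center D (q.[t])^-1 by apply/central_inv/central_poly_horner.
  by rewrite !mulrA; congr (_ / _); rewrite -!mulrA (cqt (a * _)) -!mulrA.
have Uq t : center D t -> (q * q).[t] != 0 -> U t.
  move=> ct; rewrite central_hornerM // => qt; split=> //.
  by apply: contraNneq qt => ->; rewrite mul0r.
have valK : values_in C' K (q * q).
  move=> t ct /(Uq _ ct) Ut; rewrite KE //; apply: subgroup_mul => //.
    exact: subgroup_inv.
  by apply: norm => //; apply: hC.
(* Conjugating this family by an element [w] of [C] again gives a family in [C'], which commutes
   with [a] by [comm]. *)
have commK w s : C w -> U s -> w^-1 * (a^-1 * y s) * w * a = a * (w^-1 * (a^-1 * y s) * w).
  move=> Cw Us; have uw := gC.1 _ Cw.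
  have [cs qs] := Us; have [_ [cqq _ _]] := famK.
  have qqs : (q * q).[s] != 0.
    by rewrite central_hornerM //; apply/eqP => /(division_mulf_eq0 hD)[] /eqP; apply/negP.
  rewrite -KE // -family_conj_val //; apply: comm_family_val => //.
  apply: comm (family_conj uw famK) _ => t ct qt.
  by rewrite family_conj_val //; apply: norm => //; apply: valK.
(* Taking [w = 1] shows that [y t] commutes with [a]; taking [w = (h t)^-1] and conjugating back,
   that it commutes with [a^-1 * y s]. *)
have ycomm s t : U s -> U t -> y s * y t = y t * y s.
  move=> Us Ut.
  have ay : a * y t = y t * a.
    have := commK 1 t (subgroup_one gC) Ut.
    rewrite invr1 mul1r mulr1 (mulVKr ua) => e.
    by rewrite -[y t in RHS](mulVKr ua) -mulrA e.
  have := commK (h t)^-1 s (subgroup_inv gC (hC _ Ut)) Us; rewrite invrK => e.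
  have {}e : (a^-1 * y s) * y t = y t * (a^-1 * y s).
    move: (hu _ Ut) e; rewrite /y; move: (a^-1 * _) (h t) => k g gu e.
    have -> : k * (g^-1 * a * g) = g^-1 * (g * k * g^-1 * a) * g.
      by rewrite !mulrA mulVr // mul1r.
    by rewrite e !mulrA mulrVK.
  by rewrite -[y s](mulVKr ua) -mulrA e [LHS]mulrA ay -[LHS]mulrA.
have yfin : finite_set (y @` U).
  have [mu [mmu cmu rmu]] := monic_annihilator hD alg_a.
  apply: (finite_comm_roots hD (monic_neq0 mmu)) => [_ [t Ut <-]|].
    by apply: root_conj => //; apply: hu.
  by move=> _ _ [s Us <-] [t Ut <-]; apply: ycomm.
have central_roots (Z : {poly D}) : Z != 0 -> finite_set [set t | center D t /\ Z.[t] = 0].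
  move=> Z0; apply: (finite_comm_roots hD Z0) => [t [_ /rootP]//|x t [cx _] _].
  exact: cx.
have Uinf : infinite_set U.
  move=> Ufin; apply: infF.
  apply: (@sub_finite_set _ _ (U `|` [set t | center D t /\ q.[t] = 0])).
    by move=> t ct; have [qt|qt] := eqVneq q.[t] 0; [right|left].
  by rewrite finite_setU; split=> //; apply: central_roots; apply: monic_neq0.
(* Pigeonhole: infinitely many parameters, finitely many conjugates. *)
have [c cinf] : exists c, infinite_set [set t | U t /\ y t = c].
  apply: contrapT => nc; apply: Uinf.
  apply: (@sub_finite_set _ _ (\bigcup_(c in y @` U) [set t | U t /\ y t = c])).
    by move=> t Ut; exists (y t) => //; exists t.
  by apply: bigcup_finite => // c _; apply: contrapT => fc; apply: nc; exists c.
(* Both sides agree at infinitely many central [t], hence as polynomials. *)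
have QaP : Q * a%:P * P = c%:P * (q * q).
  apply/eqP; rewrite -subr_eq0; apply: contrapT => /negP Z0; apply: cinf.
  apply: sub_finite_set (central_roots _ Z0) => t [Ut yt]; have [ct qt] := Ut.
  split=> //; rewrite hornerD hornerN !central_hornerM // !hornerC -yt.
  have := KE t Ut; rewrite /K !central_hornerM // !hornerC => /(congr1 ( *%R a)).
  have qqu : q.[t] * q.[t] \is a GRing.unit by rewrite unitrMl; apply: hD.
  by rewrite mulVKr // !mulrA divrr // mul1r => <-; rewrite -[_ / _ * _ * _]mulrA divrK ?subrr.
(* Comparing leading coefficients amounts to taking the value at infinity. *)
have ac : a = c.
  have [[/monicP lK _ _ _] _] := famK.
  apply: (mulrI (x := a^-1)); first by rewrite unitrV.
  rewrite mulVr // -lK /K -!mulrA [Q * _]mulrA QaP mulrA -polyCM.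
  by rewrite lead_coef_Mmonic ?monicMl // lead_coefC.
have mqq : q * q \is monic by rewrite monicMl.
(* Multiplying [QaP] by [P] on the left and cancelling the central [q * q] shows that [P] commutes
   with [a]. *)
apply: nPa; apply: (monic_rreg mqq).
rewrite -ac in QaP; rewrite -!mulrA -QaP !mulrA PQ.
by rewrite -[RHS]mulrA (central_polyM cq cq) [RHS]mulrA.
Qed.
End Step.
End FamiliesAlongChain.

(** * Subfields as abstract fields *)

Section SubfieldType.
Variables (D : unitRingType) (hD : is_division_ring D) (K : set D) (hK : subfield K).

(* The dummy [let] makes the closure proof recoverable from the predicate, so that
   the instances below can be inferred. *)
Definition subfield_pred : {pred D} := let _ := (hD, hK) in [in K].
Lemma subfield_pred_divring : GRing.divring_closed subfield_pred.
Proof. exact: hK.1. Qed.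
HB.instance Definition _ :=
  GRing.isDivringClosed.Build D subfield_pred subfield_pred_divring.

Definition subfield_type := {x : D | x \in subfield_pred}.
HB.instance Definition _ := SubType.on subfield_type.
HB.instance Definition _ := [Choice of subfield_type by <:].
HB.instance Definition _ := [SubChoice_isSubUnitRing of subfield_type by <:].

Lemma subfield_type_mulC : commutative ( *%R : subfield_type -> _).
Proof.
move=> x y; apply: val_inj; rewrite !rmorphM.
have kx := valP x; have ky := valP y; rewrite !inE in kx ky.
exact: hK.2.
Qed.
HB.instance Definition _ :=
  GRing.PzRing_hasCommutativeMul.Build subfield_type subfield_type_mulC.
Lemma subfield_type_field (x : subfield_type) : x != 0 -> x \is a GRing.unit.
Proof.
move=> x0; have vu : val x \is a GRing.unit.
  by apply: hD; apply: contraNneq x0 => vx; apply/eqP/val_inj; rewrite vx rmorph0.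
have kV : (val x)^-1 \in subfield_pred by rewrite rpredV; apply: valP.
by apply/unitrP; exists (Sub (val x)^-1 kV); split; apply: val_inj;
  rewrite rmorphM SubK ?mulVr ?divrr // rmorph1.
Qed.
HB.instance Definition _ :=
  GRing.ComUnitRing_isField.Build subfield_type subfield_type_field.

End SubfieldType.

Lemma subfield_embedding (D : unitRingType) (K : set D) : is_division_ring D ->
  subfield K ->
  exists (F : fieldType) (f : {rmorphism F -> D}), forall x, K x <-> exists y, f y = x.
Proof.
move=> hD hK; exists (subfield_type hD hK), val => x; split=> [Kx|[y <-]].
  have kx : x \in subfield_pred hD hK by rewrite inE.
  by exists (exist _ x kx).
by have := valP y; rewrite inE.
Qed.

(** * Subfields and centralizers *)

Section Span.
Variable (F : fieldType).
Implicit Types (C : subringClosed F).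

Definition spanned_by (C W : {pred F}) (ks : seq F) :=
  forall x, x \in W -> exists2 c : nat -> F,
    forall i, c i \in C & x = \sum_(i < size ks) c i * ks`_i.

Lemma adj_spanned C r p : p \is monic -> p \is a polyOver C -> root p r ->
  spanned_by C (adj C r) [seq r ^+ i | i <- iota 0 (size p)].
Proof.
move=> mp Cp /rootP rp _ /adjP[V CV ->].
have [j [Q [E [CQ CE ltE]]]] := pseudo_division (monic_neq0 mp) Cp CV.
rewrite (monicP mp) expr1n scale1r => ->.
exists (fun i => E`_i) => [i|]; first exact: (polyOverP CE).
rewrite !hornerE rp mulr0 add0r (horner_coef_wide _ (ltnW ltE)) size_map size_iota.
by apply: eq_bigr => i _; rewrite (nth_map 0%N) ?size_iota // nth_iota // add0n.
Qed.

Lemma spanned_trans C (B : subringClosed F) W ks ls : spanned_by C B ks ->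
  spanned_by B W ls -> spanned_by C W [seq k * l | l <- ls, k <- ks].
Proof.
move=> sB sW x /sW[c Bc ->].
suff comb (ls' : seq F) (c' : nat -> F) : (forall i, c' i \in B) ->
    exists2 d : nat -> F, forall i, d i \in C &
    \sum_(i < size ls') c' i * ls'`_i =
    \sum_(i < size [seq k * l | l <- ls', k <- ks]) d i * [seq k * l | l <- ls', k <- ks]`_i.
  exact: comb.
elim: ls' c' => [|l ls' IH] c' Bc'.
  by exists (fun _ => 0); rewrite ?big_ord0 //= => i; rewrite rpred0.
have [d Cd eqd] := IH (fun i => c' i.+1) (fun i => Bc' _).
have [b Cb eqb] := sB _ (Bc' 0%N).
exists (fun i => if (i < size ks)%N then b i else d (i - size ks)%N) => [i|].
  by case: ifP.
rewrite big_ord_recl eqd eqb /= size_cat size_map big_split_ord /= mulr_suml.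
congr (_ + _); apply: eq_bigr => i _.
  by rewrite ltn_ord nth_cat size_map ltn_ord (nth_map 0) // mulrA.
by rewrite nth_cat size_map ltnNge leq_addr /= addKn.
Qed.

Lemma adjs_spanned C (rs : seq F) :
  (forall r, r \in rs -> exists p, [/\ p \is monic, p \is a polyOver C & root p r]) ->
  exists ks, spanned_by C (adjs C rs) ks.
Proof.
elim: rs C => [|r rs IH] C mono /=.
  exists [:: 1] => x Cx; exists (fun i => if i == 0%N then x else 0).
    by move=> i; case: ifP => // _; rewrite rpred0.
  by rewrite big_ord_recl big_ord0 /= mulr1 addr0.
have [p [mp Cp rp]] := mono r (mem_head _ _).
have [r' r'rs|ks sp] := IH (adj C r).
  have r'in : r' \in r :: rs by rewrite inE r'rs orbT.
  have [p' [mp' Cp' rp']] := mono r' r'in.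
  exists p'; split=> //; apply: polyOverS Cp' => x; exact: adj_base.
by eexists; apply: spanned_trans sp; apply: adj_spanned mp Cp rp.
Qed.

End Span.

Section Centralizers.
Variable (D : unitRingType).
Hypothesis hD : is_division_ring D.

Definition centralizer (X : set D) : set D :=
  [set y | forall x, X x -> x * y = y * x].

Lemma centralizer_division X : division_subring (centralizer X).
Proof.
split=> [|x y|x y]; rewrite !inE.
- by move=> z _; rewrite mulr1 mul1r.
- by move=> cx cy z Xz; rewrite mulrBr mulrBl cx // cy.
- move=> cx cy z Xz; apply: commrM; first exact: cx.
  by apply: commrV; apply: cy.
Qed.

(** [K] and [x] commute, so the double centralizer of [K] together with [x] is a commutative
    division subring; by maximality it equals [K]. *)
Lemma maximal_subfield_self_centralizing K x : maximal_subfield K ->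
  centralizer K x -> K x.
Proof.
move=> [[dK cK] maxK] cx.
pose Z1 := centralizer (K `|` [set x]); pose Z2 := centralizer Z1.
have sub1 y : (K `|` [set x]) y -> Z1 y.
  case=> [Ky|->] z [Kz|->] //.
  - exact: cK.
  - by rewrite cx.
  - exact: cx.
have sub2 y : (K `|` [set x]) y -> Z2 y by move=> hy z hz; rewrite hz.
have <- : Z2 = K; last by apply: sub2; right.
apply: maxK; last by move=> y Ky; apply: sub2; left.
split; first exact: centralizer_division.
move=> y z Z2y Z2z; rewrite /GRing.comm -Z2y // => u hu.
by rewrite -Z2z //; apply: sub1.
Qed.

(** Removing factors ['X] from an annihilator leaves [q.[x] * x + c = 0] with [c] central and
    nonzero, whence [x^-1 = - (q.[x] * c^-1)]. *)
Lemma algebraic_subring_inv (B : set D) x : GRing.subring_closed [in B] ->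
  center D `<=` B -> algebraic_over_center x -> B x -> B x^-1.
Proof.
move=> [B1 Bsub Bmul] FB [p [p0 /polyOver_centerP cp rp]] Bx.
have BM y z : B y -> B z -> B (y * z) by have := Bmul y z; rewrite !inE.
have BB y z : B y -> B z -> B (y - z) by have := Bsub y z; rewrite !inE.
have B0 : B 0 by apply/FB/center0.
have BN y : B y -> B (- y) by rewrite -sub0r; apply: BB.
have BD y z : B y -> B z -> B (y + z) by move=> By Bz; rewrite -[z]opprK; apply/BB/BN.
have Bhor (q : {poly D}) : (forall i, center D q`_i) -> B q.[x].
  elim/poly_ind: q => [|q c IH] cq; first by rewrite horner0.
  rewrite hornerMXaddC; apply: BD.
    apply: BM => //; apply: IH => i; have := cq i.+1.
    by rewrite coefD coefMX coefC addr0.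
  by have := cq 0%N; rewrite coefD coefMX coefC add0r; apply: FB.
have [->|x0] := eqVneq x 0; first by rewrite invr0.
have ux := hD x0.
have [n] := ubnP (size p); elim: n p p0 cp rp => // n IH p p0 cp rp ltpn.
move: p0 cp rp ltpn; elim/poly_ind: p => [|q c _]; first by rewrite eqxx.
move=> p0 cp /rootP; rewrite hornerMXaddC => rp ltpn.
have cq i : center D q`_i.
  by have := cp i.+1; rewrite coefD coefMX coefC addr0.
have cc : center D c by have := cp 0%N; rewrite coefD coefMX coefC add0r.
have [c0|c0] := eqVneq c 0.
  move: rp p0 ltpn; rewrite c0 addr0 => rp p0; have q0 : q != 0.
    by apply: contraNneq p0 => ->; rewrite mul0r add0r.
  rewrite addr0 size_mulX // ltnS => ltqn; apply: (IH q) => //.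
  by apply/rootP; case/(division_mulf_eq0 hD): rp => // x00; rewrite x00 eqxx in x0.
have -> : x^-1 = - (q.[x] * c^-1).
  have uc := hD c0; move/eqP: rp; rewrite addr_eq0 => /eqP rp.
  apply: (mulIr ux); rewrite mulVr // mulNr -mulrA.
  by rewrite (central_inv cc x) mulrA rp mulNr opprK divrr.
by apply/BN/BM; [apply: Bhor | apply/FB/central_inv].
Qed.

End Centralizers.

(** * Left linear algebra over a self-centralizing subfield *)

Section LinearDependence.
Variable (D : unitRingType).
Hypothesis hD : is_division_ring D.

(** Gaussian elimination with the unknowns on the left: row [d] is solved for the unknown [j0],
    which is then eliminated from the other rows. *)
Lemma homogeneous_system_sol d (js : seq nat) (v : nat -> nat -> D) :
  uniq js -> size js = d.+1 ->
  exists2 z : nat -> D, exists2 j, j \in js & z j != 0 &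
    forall i, (i < d)%N -> \sum_(j <- js) z j * v i j = 0.
Proof.
elim: d js v => [|d IH] js v ujs sjs.
  by case: js sjs ujs => //= j js _ _; exists (fun=> 1) => //; exists j;
    rewrite ?mem_head ?oner_neq0.
have [j0 j0js piv] : exists2 j0, j0 \in js &
    v d j0 != 0 \/ forall j, j \in js -> v d j = 0.
  have [[j jjs vj]|no] := pselect (exists2 j, j \in js & v d j != 0).
    by exists j => //; left.
  case: js sjs no {ujs} => // j js _ no; exists j; first exact: mem_head.
  right=> i ijs; apply/eqP; apply: contrapT => /negP vi; apply: no.
  by exists i.
pose js' := rem j0 js; have ujs' : uniq js' by apply: rem_uniq.
have sjs' : size js' = d.+1 by rewrite size_rem // sjs.
(* If row [d] is zero, [r] vanishes on [js] and any [j0] will do. *)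
pose r j := v d j / v d j0.
have [z [j jjs zj] zsum] := IH js' (fun i j => v i j - r j * v i j0) ujs' sjs'.
have jj0 : j != j0 by apply: contraTneq jjs => ->; rewrite mem_rem_uniqF.
pose w := - \sum_(j <- js') z j * r j.
exists (fun j => if j == j0 then w else z j).
  by exists j; rewrite ?(negPf jj0) // (mem_rem jjs).
move=> i; rewrite ltnS leq_eqVlt => lti.
rewrite (big_rem j0) //= eqxx -/js'.
have -> : \sum_(j <- js') (if j == j0 then w else z j) * v i j =
          \sum_(j <- js') z j * v i j.
  rewrite !big_seq; apply: eq_bigr => k kjs; case: eqP => // kj0.
  by rewrite kj0 /js' mem_rem_uniqF in kjs.
rewrite /w mulNr addrC mulr_suml -sumrB.
case/orP: lti => [/eqP->|lti].
  rewrite big_seq big1 // => k kjs; case: piv => [vd|vd0].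
    by rewrite /r -!mulrA mulVr ?hD // mulr1 subrr.
  by rewrite /r (vd0 k (mem_rem kjs)) !(mul0r, mulr0) subrr.
rewrite -[RHS](zsum i lti); apply: eq_bigr => k _.
by rewrite mulrBr -mulrA.
Qed.

Variables (F : fieldType) (f : {rmorphism F -> D}).
Hypothesis fC : forall x, (forall k, f k * x = x * f k) -> exists k, f k = x.

(* Artin's argument: a relation of minimal length, normalized to have one
   coefficient 1, has all its coefficients in the self-centralizing subfield,
   since [z k - k z] is a shorter relation for every [k]. *)
Lemma shortest_relation (js : seq nat) (y z : nat -> D) :
  (exists2 j, j \in js & z j != 0) ->
  (forall k, \sum_(j <- js) z j * f k * y j = 0) ->
  exists2 c : nat -> F, exists2 j, j \in js & c j != 0 &
    \sum_(j <- js) f (c j) * y j = 0.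
Proof.
have [n] := ubnP (count (fun j => z j != 0) js); elim: n z => // n IH z ltn.
case=> j0 j0js zj0 rel.
pose w j := (z j0)^-1 * z j; have uz := hD zj0.
have wj0 : w j0 = 1 by rewrite /w mulVr.
have w0 j : (w j == 0) = (z j == 0).
  apply/eqP/eqP => [wj|zj]; last by rewrite /w zj mulr0.
  by rewrite -[z j](mulVKr uz) -/(w j) wj mulr0.
have wrel k : \sum_(j <- js) w j * f k * y j = 0.
  rewrite -[RHS](mulr0 (z j0)^-1) -[in RHS](rel k) mulr_sumr.
  by apply: eq_bigr => j _; rewrite /w !mulrA.
have [allK|] := pselect (forall j, j \in js -> exists k, f k = w j).
  have /choice[c cE] j : exists k, j \in js -> f k = w j.
    by have [/allK[k e]|] := boolP (j \in js); [exists k | exists 0].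
  exists c.
    by exists j0 => //; rewrite -(fmorph_eq0 f) cE // wj0 oner_neq0.
  rewrite -[RHS](wrel 1) !big_seq; apply: eq_bigr => j jjs.
  by rewrite cE // rmorph1 mulr1.
move=> nK; have [j1 [j1js [k nk]]] :
    exists j, j \in js /\ exists k, w j * f k != f k * w j.
  apply: contrapT => no; apply: nK => j jjs; apply: fC => k; apply/esym/eqP.
  by apply: contrapT => /negP ne; apply: no; exists j; split=> //; exists k.
apply: (IH (fun j => w j * f k - f k * w j)).
- rewrite ltnS in ltn; apply: leq_trans ltn.
  have sub j : (w j * f k - f k * w j != 0) ==> (z j != 0).
    by apply/implyP; apply: contraNneq => zj; rewrite /w zj mulr0 mul0r mulr0 subrr.
  have {1}-> : count (fun j => w j * f k - f k * w j != 0) js =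
      count (fun j => w j * f k - f k * w j != 0) (rem j0 js).
    have /permP -> := perm_to_rem j0js.
    by rewrite /= wj0 mul1r mulr1 subrr eqxx.
  have /permP -> := perm_to_rem j0js; rewrite /= zj0 add1n ltnS.
  by apply: sub_count => j /=; apply/implyP.
- by exists j1 => //; rewrite subr_eq0.
(* The relation at [k * l] minus [f k] times the relation at [l]. *)
move=> l; rewrite (eq_bigr (fun j => w j * f (k * l) * y j - f k * (w j * f l * y j))).
  by rewrite sumrB wrel -mulr_sumr wrel mulr0 subrr.
by move=> j _; rewrite !mulrBl rmorphM !mulrA.
Qed.

Variables (L : {pred F}) (ks : seq F).
Hypothesis ksP : spanned_by L predT ks.

(** There are more unknowns than members of [ks], so some [z] satisfies the relation at each of
    them. As the [y j] commute with the image of [L], it extends to all of [F], and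
    [shortest_relation] applies. *)
Lemma centralizer_dependent (js : seq nat) (y : nat -> D) :
  uniq js -> size js = (size ks).+1 ->
  (forall j, centralizer (f @` [set l | l \in L]) (y j)) ->
  exists2 c : nat -> F, exists2 j, j \in js & c j != 0 &
    \sum_(j <- js) f (c j) * y j = 0.
Proof.
move=> ujs sjs yC.
have [z z0 zsum] := homogeneous_system_sol (fun i j => f ks`_i * y j) ujs sjs.
apply: (shortest_relation z0) => k; have [c Lc ->] := ksP (isT : k \in predT).
transitivity (\sum_(i < size ks) (\sum_(j <- js) z j * (f ks`_i * y j)) * f (c i)).
  rewrite [RHS](eq_bigr _ (fun i _ => mulr_suml _ _ _ _)) exchange_big /=.
  apply: eq_bigr => j _; rewrite rmorph_sum mulr_sumr mulr_suml.
  apply: eq_bigr => i _; rewrite mulrC rmorphM -!mulrA; congr (_ * (_ * _)).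
  by apply: yC; exists (c i) => //=.
by apply: big1 => i _; rewrite zsum ?mul0r.
Qed.

Definition left_independent n (e : nat -> D) := forall c : nat -> F,
  \sum_(j < n) f (c j) * e j = 0 -> forall j, (j < n)%N -> c j = 0.

(** A left independent family of maximal length spans, and [centralizer_dependent] bounds the length
    by [size ks]. *)
Lemma centralizer_basis :
  exists n (e : nat -> D), [/\ left_independent n e,
    forall j, centralizer (f @` [set l | l \in L]) (e j) &
    forall x, centralizer (f @` [set l | l \in L]) x ->
      exists c : nat -> F, x = \sum_(j < n) f (c j) * e j].
Proof.
pose C := centralizer (f @` [set l | l \in L]).
pose indep n := `[< exists e : nat -> D, left_independent n e /\ forall j, C (e j) >].
have indep0 : exists n, indep n.
  exists 0%N; apply/asboolP; exists (fun=> 0); split=> // j x _.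
  by rewrite mulr0 mul0r.
have bound n : indep n -> (n <= size ks)%N.
  move=> /asboolP[e [ind Ce]]; rewrite leqNgt; apply/negP => lt.
  have [|//|c [j jin cj] sum0] := @centralizer_dependent (iota 0 (size ks).+1) e (iota_uniq _ _).
    by rewrite size_iota.
  rewrite mem_iota add0n /= in jin; move/eqP: cj; apply.
  (* The relation has [(size ks).+1] terms and is padded with zeros up to [n]. *)
  pose c' i := if (i < (size ks).+1)%N then c i else 0.
  have := ind c' _ j (leq_trans jin lt); rewrite /c' jin; apply.
  rewrite -[RHS]sum0 -{2}[(size ks).+1]subn0 -/(index_iota _ _) big_mkord.
  rewrite (big_ord_widen n (fun j => f (c j) * e j)) // [RHS]big_mkcond /=.
  by apply: eq_bigr => i _; case: ifP => // _; rewrite rmorph0 mul0r.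
case: (ex_maxnP indep0 bound) => n /asboolP[e [ind Ce]] maxn.
exists n, e; split=> // x Cx.
pose e' j := if (j < n)%N then e j else x.
have : ~ left_independent n.+1 e'.
  move=> ind'; have := maxn n.+1; rewrite ltnn => h; apply: notF; apply: h.
  by apply/asboolP; exists e'; split=> // j; rewrite /e'; case: ifP.
have e'S (c : nat -> F) : \sum_(j < n.+1) f (c j) * e' j =
    \sum_(j < n) f (c j) * e j + f (c n) * x.
  rewrite big_ord_recr /= /e' ltnn; congr (_ + _).
  by apply: eq_bigr => i _; rewrite ltn_ord.
move=> dep; apply: contrapT => nspan; apply: dep => c; rewrite e'S => sum0.
have cn : c n = 0.
  apply/eqP; apply: contrapT => /negP cn; apply: nspan.
  exists (fun j => - (c j / c n)).
  have fu : f (c n) \is a GRing.unit by apply: hD; rewrite fmorph_eq0.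
  move/eqP: sum0; rewrite addrC addr_eq0 => /eqP sum0.
  rewrite -[x](mulKr fu) sum0 mulrN mulr_sumr -sumrN; apply: eq_bigr => j _.
  by rewrite rmorphN mulNr [c j / _]mulrC rmorphM mulrA fmorphV.
move=> j; rewrite ltnS leq_eqVlt => /orP[/eqP->//|]; apply: ind.
by rewrite -[RHS]sum0 cn rmorph0 mul0r addr0.
Qed.

End LinearDependence.

Section Preimage.
Variables (D : unitRingType) (F : fieldType) (f : {rmorphism F -> D}) (A : set D).
Hypothesis hA : GRing.subring_closed [in A].

Definition preim_pred : {pred F} := let _ := hA in fun x => `[< A (f x) >].
Lemma preim_predP x : reflect (A (f x)) (x \in preim_pred).
Proof. exact: asboolP. Qed.
Lemma preim_subring : GRing.subring_closed preim_pred.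
Proof.
have [A1 AB AM] := hA; split=> [|x y /preim_predP Ax /preim_predP Ay|
  x y /preim_predP Ax /preim_predP Ay]; apply/preim_predP.
- by rewrite rmorph1; move: A1; rewrite inE.
- by rewrite rmorphB; have := AB (f x) (f y); rewrite !inE; apply.
- by rewrite rmorphM; have := AM (f x) (f y); rewrite !inE; apply.
Qed.
HB.instance Definition _ := GRing.isSubringClosed.Build F preim_pred preim_subring.
End Preimage.

Lemma lift_poly (D : nzRingType) (F : fieldType) (f : {rmorphism F -> D}) (p : {poly D}) :
  (forall i, exists y, f y = p`_i) -> exists p', map_poly f p' = p.
Proof.
move=> /choice[g gE]; exists (\poly_(i < size p) g i).
apply/polyP => i; rewrite coef_map coef_poly; case: ltnP => [_|le]; first exact: gE.
by rewrite raddf0 nth_default.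
Qed.

(** * Finite-dimensional centralizers from cofinite subsets of [S] *)

Section StronglyAlgebraic.
Variable (D : unitRingType).
Hypothesis hD : is_division_ring D.

Lemma center_adjoin_division (S : set D) : division_subring (center_adjoin S).
Proof.
split=> [|x y|x y]; rewrite !inE.
- by move=> M [[M1 _ _] _]; move: M1; rewrite inE.
- move=> Sx Sy M hM; have [[_ MB _] _] := hM.
  by have := MB x y; rewrite !inE; apply; [apply: Sx|apply: Sy].
- move=> Sx Sy M hM; have [[_ _ MV] _] := hM.
  by have := MV x y; rewrite !inE; apply; [apply: Sx|apply: Sy].
Qed.

Lemma center_adjoin_center (S : set D) z : center D z -> center_adjoin S z.
Proof. by move=> cz M [_ sub]; apply: sub; left. Qed.

Lemma center_adjoin_gen (S : set D) z : S z -> center_adjoin S z.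
Proof. by move=> Sz M [_ sub]; apply: sub; right. Qed.

Lemma center_adjoin_min (S M : set D) : division_subring M -> center D `<=` M ->
  S `<=` M -> center_adjoin S `<=` M.
Proof. by move=> dM FM SM; apply: smallest_sub => // x [/FM|/SM]. Qed.

Variables (K S : set D) (F : fieldType) (f : {rmorphism F -> D}).
Hypothesis Dalg : forall x : D, algebraic_over_center x.
Hypothesis maxK : maximal_subfield K.
Hypothesis SK : S `<=` K.
Hypothesis KS : K = center_adjoin S.
Hypothesis finS : forall x : D, finite_set [set y | S y /\ x * y <> y * x].
Hypothesis fK : forall x, K x <-> exists y, f y = x.

(** [L] corresponds to [center_adjoin S'], where [S'] omits the finitely many elements of [S] that
    fail to commute with some member of [xs]. The omitted elements are algebraic, so [F] is finitely
    spanned over [L] and [centralizer_basis] applies. *)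
Lemma cofinite_centralizer_basis (xs : seq D) :
  exists (L : subringClosed F) (ks : seq F) n (e : nat -> D),
    [/\ forall z, center D z -> exists2 l, l \in L & f l = z,
     forall x, x \in xs -> centralizer (f @` [set l | l \in L]) x &
     spanned_by L predT ks] /\
    [/\ left_independent f n e,
     forall j, centralizer (f @` [set l | l \in L]) (e j) &
     forall x, centralizer (f @` [set l | l \in L]) x ->
      exists c : nat -> F, x = \sum_(j < n) f (c j) * e j].
Proof.
pose S' := [set y | S y /\ forall x, x \in xs -> x * y = y * x].
have LK : center_adjoin S' `<=` K.
  rewrite KS; apply: center_adjoin_min; first exact: center_adjoin_division.
    by move=> z; apply: center_adjoin_center.
  by move=> z [Sz _]; apply: center_adjoin_gen.
have Lsub : GRing.subring_closed [in center_adjoin S'].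
  exact: GRing.divring_closedBM (center_adjoin_division S').
pose L : subringClosed F := preim_pred f Lsub.
have centerL z : center D z -> exists2 l, l \in L & f l = z.
  move=> cz; have Lz : center_adjoin S' z by apply: center_adjoin_center.
  by have /fK[l lz] := LK _ Lz; exists l => //; apply/preim_predP; rewrite lz.
have Tfin : finite_set (S `\` S').
  apply: (@sub_finite_set _ _ (\bigcup_(x in [set` xs]) [set y | S y /\ x * y <> y * x])).
    move=> y [Sy nS']; apply: contrapT => no; apply: nS'; split=> // x xxs.
    by apply: contrapT => ne; apply: no; exists x.
  by apply: bigcup_finite => // x _; apply: finS.
have [ts tsP] : exists ts : seq F, forall y, S y -> ~ S' y -> exists2 t, t \in ts & f t = y.
  have /finite_seqP[s sE] := Tfin.
  have /choice[g gE] y : exists t, K y -> f t = y.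
    by have [/fK[t e]|nK] := pselect (K y); [exists t | exists 0].
  exists (map g s) => y Sy nSy; exists (g y); last by apply/gE/SK.
  apply: map_f; have : (S `\` S') y by split.
  by rewrite sE.
have [|ks ksP] := @adjs_spanned F L ts.
  move=> t _; have [p [mp cp rp]] := monic_annihilator hD (Dalg (f t)).
  have {}cp := (polyOver_centerP p).1 cp.
  have [i|p' pE] := @lift_poly _ _ f p.
    by have [l _ <-] := centerL _ (cp i); exists l.
  exists p'; split.
  - by rewrite -(map_monic f) pE.
  - apply/polyOverP => i; apply/preim_predP; rewrite -coef_map pE.
    exact: center_adjoin_center.
  - by move: rp; rewrite -pE /root horner_map fmorph_eq0.
(* The image of [adjs L ts] is a ring containing the center, hence closed under inverses by
   algebraicity; it contains [S], hence all of [K]. *)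
have full y : y \in adjs L ts.
  pose B := f @` [set y | y \in adjs L ts].
  have FB : center D `<=` B.
    by move=> z /centerL[l Ll <-]; exists l => //; apply: adjs_base.
  have Bsub : GRing.subring_closed [in B].
    split=> [|x z|x z]; rewrite !inE.
    - by exists 1; rewrite ?rmorph1 //= rpred1.
    - by move=> [x' Bx <-] [z' Bz <-]; exists (x' - z'); rewrite ?rmorphB //= rpredB.
    - by move=> [x' Bx <-] [z' Bz <-]; exists (x' * z'); rewrite ?rmorphM //= rpredM.
  have Bdiv : division_subring B.
    have [B1 BB BM] := Bsub; split=> // x z Bx Bz; apply: BM => //.
    have {}Bz : B z by move: Bz; rewrite inE.
    by have := algebraic_subring_inv hD Bsub FB (Dalg z) Bz; rewrite inE.
  have : K (f y) by apply/fK; exists y.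
  rewrite KS => /(center_adjoin_min Bdiv FB)[|z By /fmorph_inj <- //].
  move=> z Sz; have [S'z|nS'z] := pselect (S' z).
    have /fK[l lz] := SK Sz; exists l => //; apply/adjs_base/preim_predP.
    by rewrite lz; apply: center_adjoin_gen.
  by have [t tts <-] := tsP z Sz nS'z; exists t => //; apply: adjs_gen.
have {}ksP : spanned_by L predT ks by move=> x _; apply: ksP.
have fC x : (forall k, f k * x = x * f k) -> exists k, f k = x.
  move=> cx; apply/fK; apply: maximal_subfield_self_centralizing maxK _.
  by move=> _ /fK[k <-].
have [n [e [ind Ce sp]]] := centralizer_basis hD fC ksP.
exists L, ks, n, e; do 2!split=> //.
move=> x xxs _ [l /preim_predP Ll <-].
suff : centralizer [set x] (f l) by move=> /(_ x erefl).
move: Ll; apply: center_adjoin_min; first exact: centralizer_division.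
  by move=> z cz _ ->; rewrite cz.
by move=> z [_ zx] _ ->; apply: zx.
Qed.

End StronglyAlgebraic.

(** * Lattices stable under a finitely generated group *)

Section Lattice.
Variables (D : unitRingType) (F : fieldType) (f : {rmorphism F -> D}).
Variables (n : nat) (e : nat -> D) (R : subringClosed F).

Definition lattice : set D :=
  [set x | exists2 c : nat -> F, forall j, c j \in R & x = \sum_(j < n) f (c j) * e j].

Lemma lattice0 : lattice 0.
Proof.
exists (fun=> 0) => [j|]; first exact: rpred0.
by rewrite big1 // => j _; rewrite rmorph0 mul0r.
Qed.

Lemma latticeD x y : lattice x -> lattice y -> lattice (x + y).
Proof.
move=> [c Rc ->] [d Rd ->]; exists (fun j => c j + d j) => [j|].
  by rewrite rpredD.
by rewrite -big_split; apply: eq_bigr => j _; rewrite rmorphD mulrDl.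
Qed.

Lemma latticeZ r x : r \in R -> lattice x -> lattice (f r * x).
Proof.
move=> Rr [c Rc ->]; exists (fun j => r * c j) => [j|]; first by rewrite rpredM.
by rewrite mulr_sumr; apply: eq_bigr => j _; rewrite rmorphM mulrA.
Qed.

Lemma latticeM x y : lattice x -> (forall j, (j < n)%N -> lattice (e j * y)) ->
  lattice (x * y).
Proof.
move=> [c Rc ->] ey; rewrite mulr_suml.
elim/big_ind: _ => [||j _]; [exact: lattice0 | exact: latticeD |].
by rewrite -mulrA; apply: latticeZ => //; apply: ey.
Qed.

Lemma lattice_basis j : (j < n)%N -> lattice (e j).
Proof.
move=> jn; exists (fun i => if i == j then 1 else 0) => [i|].
  by case: ifP; rewrite ?rpred1 ?rpred0.
rewrite (bigD1 (Ordinal jn)) //= eqxx rmorph1 mul1r big1 ?addr0 // => i.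
by rewrite -val_eqE /= => /negPf ->; rewrite rmorph0 mul0r.
Qed.

(** The units whose right multiplication is an automorphism of the lattice; by [latticeM] it is
    enough to test the [e j]. *)
Definition lattice_stabilizer : set D :=
  [set x | x \is a GRing.unit /\
     forall j, (j < n)%N -> lattice (e j * x) /\ lattice (e j * x^-1)].

Lemma lattice_stabilizer_subgroup : subgroup_of_units lattice_stabilizer.
Proof.
split=> [x []//|]; split=> [|x y]; rewrite !inE /=.
  by split=> [|j jn]; rewrite ?unitr1 // invr1 mulr1; split; apply: lattice_basis.
move=> [ux hx] [uy hy]; split; first by rewrite unitrMr ?unitrV.
move=> j jn; rewrite invrM ?unitrV // invrK !mulrA; split.
  by apply: latticeM => [|i /hy[]//]; have [] := hx j jn.
by apply: latticeM => [|i /hx[]//]; have [] := hy j jn.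
Qed.

End Lattice.

Section FinitelyGenerated.
Variables (D : unitRingType) (F : fieldType) (f : {rmorphism F -> D}).
Variables (C : set D) (n : nat) (e : nat -> D).
Hypothesis divC : division_subring C.
Hypothesis eC : forall j, C (e j).
Hypothesis ind_e : left_independent f n e.
Hypothesis span_e : forall x, C x -> exists c : nat -> F, x = \sum_(j < n) f (c j) * e j.
Hypothesis fcenter : forall z, center D z -> exists l, f l = z.
Variable A : subringClosed F.
Hypothesis fewA : few_units A.
Hypothesis Acenter : forall t, t \in A -> center D (f t).

Lemma left_independent_inj (c d : nat -> F) :
  \sum_(j < n) f (c j) * e j = \sum_(j < n) f (d j) * e j ->
  forall j, (j < n)%N -> c j = d j.
Proof.
move=> eqcd j jn; apply/eqP; rewrite -subr_eq0; apply/eqP.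
apply: (ind_e (c := fun j => c j - d j)) jn.
rewrite (eq_bigr (fun j : 'I_n => f (c j) * e j - f (d j) * e j)).
  by rewrite sumrB eqcd subrr.
by move=> i _; rewrite rmorphB mulrBl.
Qed.

(** [rs] collects the coordinates of 1 and of all [e i * g] and [e i * g^-1] with [g] in [G]. The
    lattice then contains 1 and is stable under the group, so it contains every [x = 1 * x]. *)
Lemma fg_group_in_lattice (G : set D) : finite_set G -> G `<=` unit_group D ->
  G `<=` C -> exists rs, generated_subgroup G `<=` lattice f n e (adjs A rs).
Proof.
move=> /finite_seqP[gs GE] Gu GC.
have C1 : C 1 by case: divC; rewrite inE.
have CV x y : C x -> C y -> C (x / y).
  by have [_ _ divCC] := divC; have := divCC x y; rewrite !inE.
have CM x y : C x -> C y -> C (x * y).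
  by move=> Cx Cy; rewrite -[y]invrK -[y^-1]mul1r; apply: (CV) => //; apply: (CV).
have /choice[coord coordP] x : exists c : nat -> F, C x -> x = \sum_(j < n) f (c j) * e j.
  by have [/span_e[c ->]|] := pselect (C x); [exists c | exists (fun=> 0)].
pose xs := 1 :: [seq e i * y | i <- iota 0 n, y <- gs ++ map GRing.inv gs].
pose rs := [seq coord x j | x <- xs, j <- iota 0 n].
exists rs; pose Lt := lattice f n e (adjs A rs).
have xsL x : x \in xs -> C x -> Lt x.
  move=> xxs Cx; exists (fun j => if (j < n)%N then coord x j else 0) => [j|].
    case: ifP => [jn|]; last by rewrite rpred0.
    by apply: adjs_gen; apply: allpairs_f => //; rewrite mem_iota.
  by rewrite {1}(coordP x Cx); apply: eq_bigr => j _; rewrite ltn_ord.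
have L1 : Lt 1 by apply: xsL => //; rewrite mem_head.
have sub : generated_subgroup G `<=` lattice_stabilizer f n e (adjs A rs).
  apply: smallest_sub; first exact: lattice_stabilizer_subgroup.
  move=> g Gg; have Cg := GC _ Gg; have := Gg; rewrite GE /= => ggs.
  split=> [|j jn]; first exact: Gu.
  split; apply: xsL.
  - by rewrite inE; apply/orP; right; apply: allpairs_f; rewrite ?mem_iota // mem_cat ggs.
  - exact: CM.
  - rewrite inE; apply/orP; right; apply: allpairs_f; rewrite ?mem_iota // mem_cat.
    by rewrite map_f ?orbT.
  - exact: CV.
move=> x /sub[ux hx]; rewrite -[x]mul1r; apply: latticeM => // j /hx.
by case.
Qed.

(** Each coordinate [p j] of [P] has quotients by [q'] in a finitely generated ring, so [q'] divides
    [p j]. By degree [p j] is a scalar multiple of [q']; thus [P] is a constant times [q], and both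
    are monic. *)
Lemma family_in_lattice_trivial (P Q q : {poly D}) rs : central_family P Q q ->
  (forall i, C P`_i) ->
  values_in (lattice f n e (adjs A rs)) P q -> P = q.
Proof.
move=> [[mP mQ mq sz] [cq PQ QP]] PC valP.
have cqi i : center D q`_i.
  move=> c; have := congr1 (fun p : {poly D} => p`_i) (cq c%:P).
  by rewrite coefMC coefCM.
have [i|q' qE] := @lift_poly _ _ f q; first exact: fcenter.
have q'0 : q' != 0 by rewrite -(map_poly_eq0 f) qE monic_neq0.
have /choice[coord coordP] i : exists c : nat -> F, P`_i = \sum_(j < n) f (c j) * e j.
  exact: span_e.
pose p j := \poly_(i < size P) coord i j.
have Pt t : t \in A -> P.[f t] = \sum_(j < n) f (p j).[t] * e j.
  move=> At; have ct := Acenter At; rewrite horner_coef.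
  transitivity (\sum_(i < size P) \sum_(j < n) f (coord i j * t ^+ i) * e j).
    apply: eq_bigr => i _; rewrite coordP mulr_suml; apply: eq_bigr => j _.
    rewrite rmorphM rmorphXn -!mulrA; congr (_ * _).
    by apply: commrX; apply: commr_sym; apply: ct.
  rewrite exchange_big /=; apply: eq_bigr => j _.
  by rewrite horner_poly rmorph_sum mulr_suml.
have qt t : q.[f t] = f q'.[t] by rewrite -qE horner_map.
have div j : (j < n)%N -> q' %| p j.
  move=> jn; apply: (denominator_divides fewA (rs := rs)) => // t At q't.
  have ct := Acenter At.
  have [|c Rc eqc] := valP (f t) ct; first by rewrite qt fmorph_eq0.
  have <- // : c j = (p j).[t] / q'.[t].
  apply: (left_independent_inj (d := fun j => (p j).[t] / q'.[t])) jn.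
  rewrite -eqc Pt // qt mulr_suml; apply: eq_bigr => i _.
  rewrite rmorphM fmorphV -!mulrA; congr (_ * _).
  by rewrite -qt; apply/esym/central_inv/central_poly_horner.
have scal j : (j < n)%N -> exists c, p j = c *: q'.
  move=> jn; have /dvdpP[u uE] := div j jn.
  have [->|p0] := eqVneq (p j) 0; first by exists 0; rewrite scale0r.
  have szp : (size (p j) <= size q')%N.
    apply: leq_trans (size_poly _ _) _; rewrite sz -qE size_map_poly //.
  have u0 : u != 0 by apply: contraNneq p0 => u0; rewrite uE u0 mul0r.
  exists u`_0; rewrite uE -mul_polyC -size1_polyC //.
  move: szp (q'0); rewrite uE size_mul // -size_poly_gt0; case: (size q') => [|s le _].
    by rewrite ltnn.
  by move: le; rewrite addnS /= -add1n leq_add2r.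
have /choice[c cE] j : exists c, (j < n)%N -> p j = c *: q'.
  by case: (ltnP j n) => [/scal[c ->]|]; [exists c | exists 0].
pose d := \sum_(j < n) f (c j) * e j.
have PE : P = d%:P * q.
  apply/polyP => i; rewrite coefCM.
  have [lt|le] := ltnP i (size P); last by rewrite !nth_default ?mulr0 // -sz.
  rewrite coordP mulr_suml; apply: eq_bigr => j _.
  have := congr1 (fun p : {poly F} => p`_i) (cE j (ltn_ord j)).
  rewrite coefZ coef_poly lt => ->; rewrite rmorphM -!mulrA; congr (_ * _).
  by rewrite -qE coef_map; have := cqi i; rewrite -qE coef_map; apply.
have := congr1 (fun p : {poly D} => lead_coef p) PE.
by rewrite lead_coef_Mmonic // lead_coefC (monicP mP) => d1; rewrite PE -d1 mul1r.
Qed.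

End FinitelyGenerated.

(** * Finite subrings *)

Section FiniteSubring.
Variables (D : unitRingType) (W : set D).
Hypothesis hD : is_division_ring D.
Hypothesis subW : GRing.subring_closed [in W].
Hypothesis finW : finite_set W.

Definition finite_subring_pred : {pred D} := let _ := (subW, finW, hD) in [in W].
HB.instance Definition _ :=
  GRing.isSubringClosed.Build D finite_subring_pred (subW : GRing.subring_closed finite_subring_pred).

Definition finite_subring := {x : D | x \in finite_subring_pred}.
HB.instance Definition _ := SubType.on finite_subring.
HB.instance Definition _ := [Choice of finite_subring by <:].
HB.instance Definition _ := [SubChoice_isSubNzRing of finite_subring by <:].

Let s := projT1 (cid ((finite_seqP W).1 finW)).
Let sP : W = [set` s] := projT2 (cid ((finite_seqP W).1 finW)).

Lemma finite_subring_mem (x : finite_subring) : val x \in s.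
Proof. by have := valP x; rewrite inE sP. Qed.

Definition finite_subring_index (x : finite_subring) : seq_sub s :=
  SeqSub (finite_subring_mem x).
Definition finite_subring_of_index (y : seq_sub s) : option finite_subring :=
  insub (ssval y).
Lemma finite_subring_indexK : pcancel finite_subring_index finite_subring_of_index.
Proof. by move=> x; rewrite /finite_subring_of_index valK. Qed.
HB.instance Definition _ := PCanIsCountable finite_subring_indexK.
HB.instance Definition _ : isFinite finite_subring := PCanIsFinite finite_subring_indexK.
HB.instance Definition _ := FinRing.isNzRing.Build finite_subring.

(** Wedderburn's theorem: [W] has no zero divisors because it lies in [D]. *)
Lemma finite_division_subring_comm x y : W x -> W y -> x * y = y * x.
Proof.
move=> Wx Wy; have xW : x \in finite_subring_pred by rewrite inE.
have yW : y \in finite_subring_pred by rewrite inE.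
have dom : GRing.integral_domain_axiom finite_subring.
  move=> u v uv0; have /(division_mulf_eq0 hD) : val u * val v = 0.
    by rewrite -[LHS](rmorphM (val : finite_subring -> D)) uv0 rmorph0.
  by case=> eq0; apply/orP; [left|right]; apply/eqP/val_inj; rewrite rmorph0.
have := congr1 val (@finDomain_mulrC finite_subring dom (exist _ x xW) (exist _ y yW)).
by [].
Qed.

End FiniteSubring.

Lemma finite_sums (R : nmodType) (T : nat -> set R) n :
  (forall j, finite_set (T j)) ->
  finite_set [set x | exists2 c : nat -> R, forall j, T j (c j) & x = \sum_(j < n) c j].
Proof.
move=> Tfin; elim: n => [|n IH].
  apply: (@sub_finite_set _ _ [set 0]) => // _ [c _ ->]; exact: big_ord0.
apply: sub_finite_set (finite_image2 (fun x y => x + y) IH (Tfin n)).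
by move=> _ [c Tc ->]; rewrite big_ord_recr /=; exists (\sum_(j < n) c j);
  [exists c | exists (c n)].
Qed.

Lemma finite_lattice (D : unitRingType) (F : fieldType) (f : {rmorphism F -> D}) n
  (e : nat -> D) (R : subringClosed F) : finite_set [set` R] ->
  finite_set (lattice f n e R).
Proof.
move=> finR; have fin := finite_sums n (fun j => finite_image (fun r => f r * e j) finR).
apply: sub_finite_set fin => _ [c Rc ->]; exists (fun j => f (c j) * e j) => // j.
by exists (c j) => //; apply: Rc.
Qed.

(** * Subrings with few units, or finite subrings *)

Section FewUnitsOrFinite.
Variable F : fieldType.
Implicit Types A B C : subringClosed F.

Lemma finite_subring_inv B x : finite_set [set` B] -> x \in B -> x^-1 \in B.
Proof.
move=> finB Bx; have [->|x0] := eqVneq x 0; first by rewrite invr0 rpred0.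
have [i [j [ltij eqij]]] : exists i j, (i < j)%N /\ x ^+ i = x ^+ j.
  apply: contrapT => no; apply: infinite_nat.
  apply: (@sub_finite_set _ _ ((fun i => x ^+ i) @^-1` [set` B])).
    by move=> i _; apply: rpredX.
  apply: (@finite_preimage _ _ [set` B] (fun i : nat => x ^+ i) _ finB) => i j _ _ /= eqij.
  by case: (ltngtP i j) => // lt; exfalso; apply: no; [exists i, j | exists j, i].
have xji : x ^+ (j - i) = 1.
  by apply: (mulfI (expf_neq0 i x0)); rewrite -exprD subnKC ?mulr1 // ltnW.
have -> : x^-1 = x ^+ (j - i).-1.
  by apply: (mulfI x0); rewrite -exprS prednK ?subn_gt0 // xji divff.
exact: rpredX.
Qed.

Lemma adj_finite B r p : finite_set [set` B] -> p \is a polyOver B -> p != 0 ->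
  root p r -> finite_set [set` adj B r].
Proof.
move=> finB Bp p0 rp; pose m := (lead_coef p)^-1 *: p.
have l0 : lead_coef p != 0 by rewrite lead_coef_eq0.
have Bm : m \is a polyOver B.
  rewrite polyOverZ // finite_subring_inv // lead_coefE; exact: (polyOverP Bp).
have mm : m \is monic by rewrite monicE lead_coefZ mulVf.
have rm : root m r by rewrite rootZ ?invr_eq0.
have sp := adj_spanned mm Bm rm.
set ks := map _ _ in sp.
have fin := finite_sums (size ks) (fun j => finite_image (fun c => c * ks`_j) finB).
apply: sub_finite_set fin => x /sp[c Bc ->]; exists (fun j => c j * ks`_j) => // j.
by exists (c j) => //; apply: Bc.
Qed.

Definition prime_ring : {pred F} := fun x => `[< exists m : int, x = m%:~R >].
Lemma prime_ringP x : reflect (exists m : int, x = m%:~R) (x \in prime_ring).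
Proof. exact: asboolP. Qed.
Lemma prime_ring_subring : GRing.subring_closed prime_ring.
Proof.
split=> [|_ _ /prime_ringP[m ->] /prime_ringP[k ->]|
  _ _ /prime_ringP[m ->] /prime_ringP[k ->]]; apply/prime_ringP.
- by exists 1.
- by exists (m - k); rewrite rmorphB.
- by exists (m * k); rewrite rmorphM.
Qed.
HB.instance Definition _ := GRing.isSubringClosed.Build F prime_ring prime_ring_subring.

Lemma prime_ring_min B : {subset prime_ring <= B}.
Proof. by move=> _ /prime_ringP[m ->]; apply: rpred_int. Qed.

(** An infinite prime ring is a copy of the integers, with units 1 and -1; 0 joins them as its own
    inverse. *)
Lemma infinite_prime_ring_few_units :
  infinite_set [set` prime_ring] -> few_units prime_ring.
Proof.
move=> inf; split=> //.
have inj (k : int) : k%:~R = 0 :> F -> k = 0.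
  move=> k0; apply: contrapT => /eqP kn0; apply: inf.
  apply: sub_finite_set (finite_image (fun i : nat => i%:R : F) (finite_II `|k|%N)).
  move=> _ /prime_ringP[m ->]; exists `|(m %% k)%Z|%N.
    by rewrite /= -ltz_nat gez0_abs ?modz_ge0 // abszE ltz_mod.
  rewrite [in RHS](divz_eq m k) rmorphD rmorphM /= k0 mulr0 add0r.
  by rewrite -[in RHS](gez0_abs (modz_ge0 m kn0)) -pmulrn.
apply: (@sub_finite_set _ _ [set 0; 1; -1]); last by rewrite !finite_setU; do !split; exact: finite_set1.
move=> _ [/prime_ringP[m ->] /prime_ringP[k mk]].
have [->|m0] := eqVneq (m%:~R : F) 0; first by left; left.
have : m * k = 1.
  by apply/eqP; rewrite -subr_eq0; apply/eqP/inj; rewrite rmorphB rmorphM /= -mk divff // subrr.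
move=> mk1; have : m \is a GRing.unit by apply/unitrP; exists k; rewrite mulrC mk1.
by rewrite qualifE /= => /orP[]/eqP->; [left; right|right].
Qed.

(** [adj A z] is a polynomial ring over a finite domain, so its units are constants from [A]. *)
Lemma transcendental_few_units A z : finite_set [set` A] ->
  (forall p, p \is a polyOver A -> root p z -> p = 0) -> few_units (adj A z).
Proof.
move=> finA trans; split.
  move=> fin; apply: infinite_nat.
  apply: (@sub_finite_set _ _ ((fun i => z ^+ i) @^-1` [set` adj A z])).
    by move=> i _; apply: rpredX; apply: adj_gen.
  apply: (@finite_preimage _ _ [set` adj A z] (fun i : nat => z ^+ i) _ fin) => i j _ _ /= eqij.
  have /(congr1 (fun p : {poly F} => p`_i)) : 'X^i - 'X^j = 0 :> {poly F}.
    apply: trans; first by rewrite rpredB ?polyOverXn.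
    by apply/rootP; rewrite hornerD hornerN !hornerXn eqij subrr.
  rewrite coefB !coefXn eqxx coef0 => /eqP; rewrite subr_eq0.
  by have [//|_] := eqVneq i j; rewrite oner_eq0.
apply: (@sub_finite_set _ _ ([set 0] `|` [set` A])); last by rewrite finite_setU.
move=> _ [/adjP[p Ap ->] /adjP[q Aq pq]]; have [->|pz] := eqVneq p.[z] 0; first by left.
right; have pq1 : p * q = 1.
  apply/eqP; rewrite -subr_eq0; apply/eqP/trans.
    by rewrite rpredB ?rpredM ?rpred1.
  by apply/rootP; rewrite hornerD hornerN hornerM hornerC -pq divff // subrr.
have : p \is a GRing.unit by apply/unitrP; exists q; rewrite mulrC pq1.
rewrite poly_unitE => /andP[/eqP sz _].
rewrite (size1_polyC (eq_leq sz)) hornerC; exact: (polyOverP Ap).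
Qed.

Variable Z : subringClosed F.
Hypothesis noA : ~ exists A, few_units A /\ {subset A <= Z}.

Lemma prime_ring_finite : finite_set [set` prime_ring].
Proof.
apply: contrapT => /infinite_prime_ring_few_units few; apply: noA.
by exists (prime_ring : subringClosed F); split=> //; apply: prime_ring_min.
Qed.

(** Otherwise [adj prime_ring z] would be a subring of [Z] with few units. *)
Lemma algebraic_over_prime_ring z : z \in Z ->
  exists p, [/\ p \is a polyOver prime_ring, p != 0 & root p z].
Proof.
move=> Zz; apply: contrapT => no; apply: noA; exists (adj prime_ring z : subringClosed F); split.
  apply: transcendental_few_units; first exact: prime_ring_finite.
  move=> p Ap rp; apply/eqP; apply: contrapT => /negP p0; apply: no.
  by exists p.
apply: (@adjs_min _ _ [:: z]) => [x|x]; first exact: prime_ring_min.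
by rewrite inE => /eqP->.
Qed.

Lemma adjs_central_finite B (zs : seq F) : finite_set [set` B] ->
  {subset zs <= Z} -> finite_set [set` adjs B zs].
Proof.
elim: zs B => //= z zs IH B finB sub; apply: IH; last first.
  by move=> x xzs; apply: sub; rewrite inE xzs orbT.
have [p [Ap p0 rp]] := algebraic_over_prime_ring (sub _ (mem_head _ _)).
apply: (@adj_finite _ _ p) => //.
by apply: polyOverS Ap; apply: prime_ring_min.
Qed.

Variable L : subringClosed F.
Hypothesis ZL : {subset Z <= L}.
Hypothesis algL : forall x, exists p, [/\ p \is a polyOver Z, p != 0 & root p x].

(** Before [l] is adjoined to [B], the coefficients of its annihilator are; they lie in [Z], hence
    are algebraic over the finite prime ring, and both adjunctions preserve finiteness. *)
Lemma finite_subring_ex (ls : seq F) : {subset ls <= L} ->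
  exists B, [/\ finite_set [set` B], {subset B <= L} & {subset ls <= B}].
Proof.
elim: ls => [|l ls IH] sub.
  by exists (prime_ring : subringClosed F); split=> //; [apply: prime_ring_finite | apply: prime_ring_min].
have [|B [finB BL lsB]] := IH; first by move=> x xls; apply: sub; rewrite inE xls orbT.
have [p [Zp p0 rp]] := algL l.
have pZ : {subset (p : seq F) <= Z}.
  by move=> x /(nthP 0)[i _ <-]; apply: (polyOverP Zp).
have finB' := adjs_central_finite finB pZ.
have Bp : p \is a polyOver (adjs B p).
  apply/polyOverP => i; have [lt|le] := ltnP i (size p).
    by apply: adjs_gen; apply: mem_nth.
  by rewrite nth_default // rpred0.
exists (adj (adjs B p) l : subringClosed F); split; first exact: adj_finite Bp p0 rp.
  apply: (@adjs_min _ _ [:: l]) => [x|x]; last by rewrite inE => /eqP->; apply: sub; rewrite mem_head.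
  by apply: adjs_min x => y hy; [apply: BL | apply/ZL/pZ].
move=> x; rewrite inE => /orP[/eqP->|xls]; first exact: adj_gen.
by apply/adj_base/adjs_base/lsB.
Qed.

End FewUnitsOrFinite.

(** * Strongly algebraic division rings *)

Lemma center_subring (D : unitRingType) : GRing.subring_closed [in center D].
Proof.
split=> [|x y|x y]; rewrite !inE => *.
- by move=> z; apply: commr_sym; apply: commr1.
- by move=> z; apply: commr_sym; apply: commrB; apply: commr_sym.
- by move=> z; apply: commr_sym; apply: commrM; apply: commr_sym.
Qed.

Section StronglyAlgebraicTheorem.
Variable (D : unitRingType) (K S : set D) (F : fieldType) (f : {rmorphism F -> D}).
Hypothesis hD : is_division_ring D.
Hypothesis Dalg : forall x : D, algebraic_over_center x.
Hypothesis maxK : maximal_subfield K.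
Hypothesis SK : S `<=` K.
Hypothesis KS : K = center_adjoin S.
Hypothesis finS : forall x : D, finite_set [set y | S y /\ x * y <> y * x].
Hypothesis fK : forall x, K x <-> exists y, f y = x.

Let Z : subringClosed F := preim_pred f (center_subring D).

(** The products [f k * e j] span the centralizer over [L]. Their structure constants and the
    coordinates of [a], [b] and 1 lie in a finite subring [B], so the lattice over [B] is a finite
    ring containing [a] and [b], and Wedderburn's theorem applies. *)
Lemma no_few_units_commutative (a b : D) :
  ~ (exists A : subringClosed F, few_units A /\ {subset A <= Z}) -> a * b = b * a.
Proof.
move=> noA.
have [L [ks [n [e [[FL Cxs ksP] [_ Ce sp]]]]]] :=
  cofinite_centralizer_basis hD Dalg maxK SK KS finS fK [:: a; b].
set C := centralizer _ in Cxs Ce sp.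
have Cdiv : division_subring C := centralizer_division _.
have Csub := GRing.divring_closedBM Cdiv.
have CM x y : C x -> C y -> C (x * y).
  by have [_ _ M] := Csub; have := M x y; rewrite !inE.
pose es := [seq f k * e j | k <- ks, j <- iota 0 n]; pose m := size es.
have CK k : C (f k) by move=> _ [l _ <-]; rewrite -!rmorphM mulrC.
have Ces u : u \in es -> C u by move=> /allpairsP[[k j] [_ _ ->]]; apply: CM.
have esL (R : subringClosed F) u : u \in es -> lattice f m (nth 0 es) R u.
  by move=> /(nthP 0)[t tm <-]; apply: lattice_basis.
have CL x : C x -> lattice f m (nth 0 es) L x.
  move=> /sp[c ->]; elim/big_ind: _ => [||j _]; [exact: lattice0 | exact: latticeD |].
  have [d Ld ->] := ksP (c j) isT; rewrite rmorph_sum mulr_suml.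
  elim/big_ind: _ => [||i _]; [exact: lattice0 | exact: latticeD |].
  rewrite rmorphM -mulrA; apply: latticeZ => //; apply: esL.
  by apply: allpairs_f; rewrite ?mem_nth // mem_iota /=.
have /choice[coord coordP] x : exists c : nat -> F, C x ->
    (forall j, c j \in L) /\ x = \sum_(j < m) f (c j) * es`_j.
  by have [/CL[c Lc ->]|] := pselect (C x); [exists c | exists (fun=> 0)].
pose xs := [:: a; b; 1] ++ [seq u * v | u <- es, v <- es].
have Cx x : x \in xs -> C x.
  rewrite mem_cat => /orP[|/allpairsP[[u v] [ues ves ->]]]; last by apply: CM; apply: Ces.
  rewrite !inE => /or3P[] /eqP->; first by apply: Cxs; rewrite mem_head.
    by apply: Cxs; rewrite !inE eqxx orbT.
  by have [C1 _ _] := Csub; move: C1; rewrite inE.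
pose ls := [seq coord x j | x <- xs, j <- iota 0 m].
have lsL : {subset ls <= L}.
  by move=> _ /allpairsP[[x j] [/Cx/coordP[Lx _] _ ->]]; apply: Lx.
have ZL : {subset Z <= L}.
  by move=> z /preim_predP/FL[l Ll /fmorph_inj <-].
have algZ x : exists p, [/\ p \is a polyOver Z, p != 0 & root p x].
  have [p [p0 /polyOver_centerP cp rp]] := Dalg (f x).
  have [i|p' pE] := @lift_poly _ _ f p.
    by have [l _ <-] := FL _ (cp i); exists l.
  exists p'; split.
  - by apply/polyOverP => i; apply/preim_predP; rewrite -coef_map pE; apply: cp.
  - by rewrite -(map_poly_eq0 f) pE.
  - by move: rp; rewrite -pE /root horner_map fmorph_eq0.
have [B [finB BL lsB]] := finite_subring_ex noA ZL algZ lsL.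
pose La := lattice f m (nth 0 es) B.
have xsLa x : x \in xs -> La x.
  move=> xxs; have [_ xE] := coordP _ (Cx _ xxs).
  exists (fun j => if (j < m)%N then coord x j else 0) => [j|].
    case: ifP => [jm|]; last by rewrite rpred0.
    by apply: lsB; apply: allpairs_f => //; rewrite mem_iota.
  by rewrite {1}xE; apply: eq_bigr => j _; rewrite ltn_ord.
have Lasub : GRing.subring_closed [in La].
  split=> [|x y|x y]; rewrite !inE.
  - by apply: xsLa; rewrite !inE eqxx !orbT.
  - move=> Lx Ly; apply: latticeD => //; rewrite -mulN1r -(rmorph1 f) -rmorphN.
    by apply: latticeZ; rewrite ?rpredN ?rpred1.
  - move=> Lx [c Bc ->]; apply: latticeM => // j jm; rewrite mulr_sumr.
    elim/big_ind: _ => [||i _]; [exact: lattice0 | exact: latticeD |].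
    (* The spanning vectors centralize the image of [L], so the scalar [f (c i)] can be moved to the
       left. *)
    rewrite mulrA -(Ces _ (mem_nth 0 jm)); last by exists (c i) => //; apply: BL.
    rewrite -mulrA; apply: latticeZ => //; apply: xsLa.
    by rewrite mem_cat; apply/orP; right; apply: allpairs_f; apply: mem_nth.
apply: (finite_division_subring_comm hD Lasub (finite_lattice _ _ _ finB)).
  by apply: xsLa; rewrite !inE eqxx.
by apply: xsLa; rewrite !inE eqxx !orbT.
Qed.

Lemma fg_subnormal_central (N : set D) :
  subnormal_in_units N -> finitely_generated N -> N `<=` center D.
Proof.
move=> [r [H [H0 HN normH]]] [G [finG Gu NG]] a Na b.
have [noA|[A [fewA AZ]]] :
    ~ (exists A : subringClosed F, few_units A /\ {subset A <= Z}) \/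
    exists A : subringClosed F, few_units A /\ {subset A <= Z}.
- by have [|] := pselect (exists A : subringClosed F, few_units A /\ {subset A <= Z}); [right|left].
- exact: no_few_units_commutative.
apply: contrapT => nab.
have Acenter t : t \in A -> center D (f t) by move=> /AZ/preim_predP.
have infF : infinite_set (center D).
  move=> fin; apply: fewA.1.
  apply: (@sub_finite_set _ _ (f @^-1` center D)); first by move=> t /Acenter.
  by apply: finite_preimage fin => x y _ _ /fmorph_inj.
have Ha k i : (i + k = r)%N -> H i a.
  elim: k i => [|k IH] i; first by rewrite addn0 => ->; rewrite HN.
  move=> ikr; have [|_ _ sub _] := normH i; first by rewrite -ikr -addSnnS leq_addr.
  by apply/sub/IH; rewrite addSnnS.
have fam i : (i <= r)%N -> exists P Q q,
    [/\ central_family P Q q, values_in (H i) P q & P * a%:P <> a%:P * P].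
  elim: i => [_|i IH lt].
    have [P [Q [q [mu [fam PE mmu cmu]]]]] := family_linear hD (Dalg (- b)).
    exists P, Q, q; split=> //.
      by move=> t ct qt; rewrite H0; have [] := family_valV hD fam ct qt.
    (* Cancelling [mu] would leave ['X + b%:P] commuting with [a], hence [b] commuting with [a]. *)
    rewrite PE -mulrA -cmu !mulrA => /(monic_rreg mmu)/(congr1 (fun p : {poly D} => p`_0)).
    by rewrite coefMC coefCM coefD coefX coefC add0r => ba; apply: nab.
  have [P [Q [q [famP valP nPa]]]] := IH (ltnW lt).
  apply: (noncommuting_family_step hD infF (normH i lt) _ (Dalg a) famP valP nPa).
  exact: Ha (subnKC lt).
have [P [Q [q [famP valP nPa]]]] := fam r (leqnn r).
have [gs GE] := (finite_seqP G).1 finG.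
(* The coefficients of [P] join the generators of [N], so that they too have coordinates with
   respect to [e]. *)
have [L [ks [n [e [[FL Cxs ksP] [ind Ce sp]]]]]] :=
  cofinite_centralizer_basis hD Dalg maxK SK KS finS fK (gs ++ (P : seq D)).
have divC := centralizer_division (f @` [set l | l \in L]).
have fcenter z : center D z -> exists l, f l = z by move=> /FL[l _ <-]; exists l.
have GC : G `<=` centralizer (f @` [set l | l \in L]).
  by rewrite GE => g /= ggs; apply: Cxs; rewrite mem_cat ggs.
have [rs Nrs] := fg_group_in_lattice divC Ce sp A finG Gu GC.
apply: nPa; have [_ [cq _ _]] := famP.
suff -> : P = q by rewrite cq.
apply: (family_in_lattice_trivial (rs := rs) ind sp fcenter fewA Acenter famP).
  move=> i; have [lt|le] := ltnP i (size P).
    by apply: Cxs; rewrite mem_cat mem_nth ?orbT.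
  by rewrite nth_default // => x _; rewrite mulr0 mul0r.
by move=> t ct qt; apply: Nrs; rewrite -NG -HN; apply: valP.
Qed.

End StronglyAlgebraicTheorem.

Theorem theorem4p1 (D : unitRingType) (hD : is_division_ring D)
  (halg : strongly_algebraic D) (N : set D)
  (hN : subnormal_in_units N) (hfg : finitely_generated N) :
  N `<=` center D.
Proof.
have [Dalg [K [maxK [S [SK KS finS]]]]] := halg.
have [F [f fK]] := subfield_embedding hD maxK.1.
exact (fg_subnormal_central hD Dalg maxK SK KS finS fK hN hfg).
Qed.
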